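(* Let $G(\lambda)\in\mathbb F(\lambda)^{m\times m}$ and let $\mathbb L_2(\lambda)$ be an $\mathbb M_2$-strong linearization of $G(\lambda)$ as in the context. (a) If $\begin{bmatrix}H_1(\lambda)\\H_2(\lambda)\end{bmatrix}$ ($H_1$ with $n$ rows) is a right minimal basis of $\mathbb L_2(\lambda)$, then $(w^T\otimes I_m)H_2(\lambda)$ is a right minimal basis of $G(\lambda)$ and $H_1(\lambda)=-S^{-1}(\lambda I_n-A)^{-1}B(w^T\otimes I_m)H_2(\lambda)$. (b) If $H(\lambda)$ is a right minimal basis of $G(\lambda)$, then $\begin{bmatrix}H_1(\lambda)\\H_2(\lambda)\end{bmatrix}$ is a right minimal basis of $\mathbb L_2(\lambda)$, where $H_1(\lambda)=-S^{-1}(\lambda I_n-A)^{-1}BH(\lambda)$ and $H_2(\lambda)=\begin{bmatrix}w^T\otimes I_m\\ J^{\mathcal B}\end{bmatrix}^{-1}\begin{bmatrix}H(\lambda)\\ -\widehat N_2(\lambda)m^D_\Phi(\lambda)^{\mathcal B}H(\lambda)\end{bmatrix}$, with $\widehat N_2(\lambda)=Q(\lambda)^T\otimes I_m$ and $Q(\lambda)=\begin{bmatrix}M_\Phi(\lambda)\\ e_k^T\end{bmatrix}^{-1}\begin{bmatrix}I_{k-1}\\0\end{bmatrix}$. (c) $\begin{bmatrix}H_1(\lambda)\\H_2(\lambda)\\\vdots\\H_{k+1}(\lambda)\end{bmatrix}$ ($H_1$ with $n$ rows, the others with $m$ rows) is a left minimal basis of $\mathbb L_2(\lambda)$ if and only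 if $H_{k+1}(\lambda)$ is a left minimal basis of $G(\lambda)$, $H_1(\lambda)=(C(\lambda I_n-A)^{-1}T^{-1})^TH_{k+1}(\lambda)$ and $H_i(\lambda)=\phi_{k-i+1}(\lambda)H_{k+1}(\lambda)$ for $i=2,\dots,k$. (d) If $\varepsilon_1\le\dots\le\varepsilon_l$ are the right minimal indices of $G(\lambda)$, then they are also the right minimal indices of $\mathbb L_2(\lambda)$. (e) If $\eta_1\le\dots\le\eta_l$ are the left minimal indices of $G(\lambda)$, then $\eta_1+k-1\le\dots\le\eta_l+k-1$ are the left minimal indices of $\mathbb L_2(\lambda)$.
   Context: $\mathbb F$ is an arbitrary field. Let $\{\phi_j(\lambda)\}_{j\ge0}$ be a polynomial basis of $\mathbb F[\lambda]$ with $\deg\phi_j=j$ satisfying $\alpha_j\phi_{j+1}(\lambda)=(\lambda-\beta_j)\phi_j(\lambda)-\gamma_j\phi_{j-1}(\lambda)$, $\alpha_j\ne0$, $\phi_{-1}=0$, $\phi_0=1$. Let $G=D+C(\lambda I_n-A)^{-1}B$ with $D$ the polynomial part, $\deg D\ge2$, and $C(\lambda I_n-A)^{-1}B$ a minimal order state-space realization of the strictly proper part. Write $D=\sum_{j=0}^kD_j\phi_j$, $D_k\ne0$. Define $m^D_\Phi(\lambda)=\big[\tfrac{\lambda-\beta_{k-1}}{\alpha_{k-1}}D_k+D_{k-1}\ \ D_{k-2}-\tfrac{\gamma_{k-1}}{\alpha_{k-1}}D_k\ \ D_{k-3}\ \cdots\ D_1\ \ D_0\big]$ ($m\times km$) and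 $M_\Phi(\lambda)\in\mathbb F[\lambda]^{(k-1)\times k}$ whose row $i$ has entries $-\alpha_{k-1-i}$, $\lambda-\beta_{k-1-i}$, $-\gamma_{k-1-i}$ in columns $i,i+1,i+2$ (last row: $-\alpha_0$, $\lambda-\beta_0$ in columns $k-1,k$), zeros elsewhere. $e_k$ is the last column of $I_k$. For a $km\times lm$ pencil $Q=\sum_{i=1}^k\sum_{j=1}^le_ie_j^T\otimes Q_{ij}$ with $m\times m$ blocks $Q_{ij}$, its block transpose is $Q^{\mathcal B}=\sum_{i,j}e_je_i^T\otimes Q_{ij}$ (blocks transposed in position but not internally). Let $w\in\mathbb F^k$, $J\in\mathbb F^{km\times(k-1)m}$ with $\begin{bmatrix}w^T\otimes I_m\\ J^{\mathcal B}\end{bmatrix}$ nonsingular, and $T,S\in\mathbb F^{n\times n}$ nonsingular. The $\mathbb M_2$-strong linearization is $\mathbb L_2(\lambda)=\begin{bmatrix}T(\lambda I_n-A)S & TB & 0_{n\times(k-1)m}\\ \begin{bmatrix}0_{(k-1)m\times n}\\ -CS\end{bmatrix} & m^D_\Phi(\lambda)^{\mathcal B} & M_\Phi(\lambda)^T\otimes I_m\end{bmatrix}\begin{bmatrix}I_n&0\\0&w^T\otimes I_m\\0&J^{\mathcal B}\end{bmatrix}$. A right (left) minimal basis of a rational matrix $G$ is a polynomial matrix whose columns form a minimal basis (polynomial basis of least total degree) of $\mathcal N_r(G)=\{x:Gx=0\}$ ($\mathcal N_\ell(G)=\{x:x^TG=0\}$); minimal indices are the degrees of its vectors. *)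

(* Defs.v *)
From HB Require Import structures.
From mathcomp Require Import all_boot all_order all_algebra fraction.
Set Implicit Arguments. Unset Strict Implicit. Unset Printing Implicit Defensive.
Import GRing.Theory.
Local Open Scope ring_scope.

Notation "x %:F" := (@FracField.tofrac _ x).

Section Defs.
Variable F : fieldType.

Definition RF := {fraction {poly F}}.

Definition lamF : RF := ('X : {poly F})%:F.

Definition liftC p q (M : 'M[F]_(p, q)) : 'M[RF]_(p, q) :=
  map_mx (fun a => (a%:P : {poly F})%:F) M.
Definition liftP p q (M : 'M[{poly F}]_(p, q)) : 'M[RF]_(p, q) :=
  map_mx (fun a => a%:F) M.
Definition polyM p q (M : 'M[F]_(p, q)) : 'M[{poly F}]_(p, q) := map_mx polyC M.

Definition resolvent n (A : 'M[F]_n) : 'M[RF]_n := invmx (lamF%:M - liftC A).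

Definition transfer n m (A : 'M[F]_n) (B : 'M[F]_(n, m)) (C : 'M[F]_(m, n)) : 'M[RF]_m :=
  liftC C *m resolvent A *m liftC B.

Definition minimal_realization n m (A : 'M[F]_n) (B : 'M[F]_(n, m)) (C : 'M[F]_(m, n)) :=
  forall n' (A' : 'M[F]_n') (B' : 'M[F]_(n', m)) (C' : 'M[F]_(m, n')),
    transfer A' B' C' = transfer A B C -> (n <= n')%N.

(* The polynomial basis phi_j defined by the three-term recurrence
   alpha_j phi_{j+1} = (X - beta_j) phi_j - gamma_j phi_{j-1}, phi_{-1}=0, phi_0=1.
   phi2 j = (phi_{j-1}, phi_j). *)
Fixpoint phi2 (al be ga : nat -> F) (j : nat) : {poly F} * {poly F} :=
  match j with
  | 0 => (0, 1)
  | j'.+1 => let: (p, q) := phi2 al be ga j' in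
             (q, (al j')^-1 *: (('X - (be j')%:P) * q - ga j' *: p))
  end.
Definition phi al be ga j := (phi2 al be ga j).2.

(* Kronecker product P (x) Q, with row-major block indexing via mxvec_index
   (mxvec_index i a is the flattened index of block i, inner index a). *)
Definition kron (R : nzRingType) a b c d (P : 'M[R]_(a, b)) (Q : 'M[R]_(c, d))
  : 'M[R]_(a * c, b * d) :=
  \matrix_(r, s) match mxvec_indexP r, mxvec_indexP s with
                 | isMxvecIndex i1 i2, isMxvecIndex j1 j2 => P i1 j1 * Q i2 j2
                 end.

Definition blockT (R : nzRingType) m p q (Q : 'M[R]_(p * m, q * m)) : 'M[R]_(q * m, p * m) :=
  \matrix_(r, s) match mxvec_indexP r, mxvec_indexP s with
                 | isMxvecIndex j b, isMxvecIndex i a => Q (mxvec_index i b) (mxvec_index j a)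
                 end.

Definition blockT_row (R : nzRingType) m k (Q : 'M[R]_(m, k * m)) : 'M[R]_(k * m, m) :=
  \matrix_(r, s) match mxvec_indexP r with
                 | isMxvecIndex i a => Q a (mxvec_index i s)
                 end.

Definition rblock m k r (X : 'M[{poly F}]_(k * m, r)) (i : 'I_k) : 'M[{poly F}]_(m, r) :=
  \matrix_(a, c) X (mxvec_index i a) c.

(* --- Data of the linearization. Throughout k = k1.+1 (so k - 1 = k1). --- *)

Definition Dpoly al be ga m k1 (Dc : nat -> 'M[F]_m) : 'M[{poly F}]_m :=
  \sum_(j < k1.+2) phi al be ga j *: polyM (Dc j).

Definition mD_block al be ga m k1 (Dc : nat -> 'M[F]_m) (j : nat) : 'M[{poly F}]_m :=
  if j == 0%N then
    ((al k1)^-1 *: ('X - (be k1)%:P)) *: polyM (Dc k1.+1) + polyM (Dc k1)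
  else if j == 1%N then
    polyM (Dc k1.-1) - polyM (((ga k1) / (al k1)) *: Dc k1.+1)
  else polyM (Dc (k1 - j)%N).

Definition mD al be ga m k1 (Dc : nat -> 'M[F]_m) : 'M[{poly F}]_(m, k1.+1 * m) :=
  \matrix_(a, s) match mxvec_indexP s with
                 | isMxvecIndex j b => mD_block al be ga k1 Dc j a b
                 end.

Definition MPhi (al be ga : nat -> F) k1 : 'M[{poly F}]_(k1, k1.+1) :=
  \matrix_(i, j) let t := (k1 - 1 - i)%N in
    if (j : nat) == i then - (al t)%:P
    else if (j : nat) == i.+1 then 'X - (be t)%:P
    else if (j : nat) == i.+2 then - (ga t)%:P
    else 0.

Definition wI m k (w : 'cV[F]_k) : 'M[F]_(m, k * m) :=
  castmx (mul1n m, erefl) (kron w^T (1%:M : 'M[F]_m)).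

Definition Wmat m k1 (w : 'cV[F]_k1.+1) (J : 'M[F]_(k1.+1 * m, k1 * m)) : 'M[F]_(k1.+1 * m) :=
  col_mx (wI m w) (blockT J).

Definition lastblk m k1 n (X : 'M[{poly F}]_(m, n)) : 'M[{poly F}]_(k1.+1 * m, n) :=
  castmx (esym (mulSnr k1 m), erefl) (col_mx (0 : 'M_(k1 * m, n)) X).

Definition L2 al be ga m n k1 (Dc : nat -> 'M[F]_m) (A : 'M[F]_n) (B : 'M[F]_(n, m))
  (C : 'M[F]_(m, n)) (w : 'cV[F]_k1.+1) (J : 'M[F]_(k1.+1 * m, k1 * m)) (T S : 'M[F]_n)
  : 'M[{poly F}]_(n + k1.+1 * m) :=
  block_mx (polyM T *m ('X%:M - polyM A) *m polyM S) (row_mx (polyM (T *m B)) 0)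
           (lastblk k1 (- polyM (C *m S)))
           (row_mx (blockT_row (mD al be ga k1 Dc)) (kron (MPhi al be ga k1)^T (1%:M : 'M_m)))
  *m block_mx (1%:M : 'M_n) 0 0 (polyM (Wmat w J)).

Definition Gmat al be ga m n k1 (Dc : nat -> 'M[F]_m) (A : 'M[F]_n) (B : 'M[F]_(n, m))
  (C : 'M[F]_(m, n)) : 'M[RF]_m :=
  liftP (Dpoly al be ga k1 Dc) + transfer A B C.

Definition right_poly_basis p q (G : 'M[RF]_(p, q)) r (N : 'M[{poly F}]_(q, r)) :=
  [/\ G *m liftP N = 0,
      row_free (liftP N)^T &
      forall x : 'cV[RF]_q, G *m x = 0 -> exists c : 'cV[RF]_r, x = liftP N *m c].

Definition coldeg q r (N : 'M[{poly F}]_(q, r)) (j : 'I_r) : nat :=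
  \max_(i < q) (size (N i j)).-1.
Definition totdeg q r (N : 'M[{poly F}]_(q, r)) : nat := \sum_(j < r) coldeg N j.
Definition col_degs q r (N : 'M[{poly F}]_(q, r)) : seq nat := [seq coldeg N j | j <- enum 'I_r].

Definition right_minimal_basis p q (G : 'M[RF]_(p, q)) r (N : 'M[{poly F}]_(q, r)) :=
  right_poly_basis G N /\
  forall r' (N' : 'M[{poly F}]_(q, r')), right_poly_basis G N' -> (totdeg N <= totdeg N')%N.

(* left null space {x : x^T G = 0} = right null space of G^T *)
Definition left_minimal_basis p q (G : 'M[RF]_(p, q)) r (N : 'M[{poly F}]_(p, r)) :=
  right_minimal_basis G^T N.

Definition right_min_indices p q (G : 'M[RF]_(p, q)) (s : seq nat) :=
  (exists r (N : 'M[{poly F}]_(q, r)), right_minimal_basis G N /\ sort leq (col_degs N) = s) /\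
  (forall r (N : 'M[{poly F}]_(q, r)), right_minimal_basis G N -> sort leq (col_degs N) = s).
Definition left_min_indices p q (G : 'M[RF]_(p, q)) (s : seq nat) :=
  right_min_indices G^T s.

Definition Qmat (al be ga : nat -> F) k1 : 'M[RF]_(k1.+1, k1) :=
  invmx (castmx (addn1 k1, erefl)
           (col_mx (liftP (MPhi al be ga k1)) (liftC (delta_mx 0 ord_max : 'M[F]_(1, k1.+1)))))
  *m castmx (addn1 k1, erefl) (col_mx (1%:M : 'M[RF]_k1) 0).

Definition N2hat (al be ga : nat -> F) m k1 : 'M[RF]_(k1 * m, k1.+1 * m) :=
  kron (Qmat al be ga k1)^T (1%:M : 'M[RF]_m).

End Defs.

(* Main.v *)
(** Solving the equations [L2 x = 0] and [x^T L2 = 0] block by block shows that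
    their solutions are parametrized by the null vectors of [G]: the first block is
    recovered through the resolvent of [A], and the others through the unimodular
    matrix [[M_Phi; e_k^T]], for which [Q M_Phi + Phi e_k^T = I] with
    [Phi = (phi_(k-1), ..., phi_0)^T].  Minimality of the realization is what makes
    the parametrization preserve polynomial vectors: if [(X - A) x] and [C x] are
    polynomial and [(A, C)] is observable then [x] is polynomial.  Degrees are
    compared through identities [X x = K x + y] with [K] constant, which force
    [deg x <= deg y].  The correspondence therefore shifts all degrees by the same
    amount ([0] on the right, [k - 1] on the left), so it matches minimal bases. *)
Require Import Defs.
From HB Require Import structures.
From mathcomp Require Import all_boot all_order all_algebra fraction zify ring.
Import GRing.Theory.
Local Open Scope ring_scope.

(** * Polynomial matrices and transfer of minimal bases *)

Section Lifting.
Set Implicit Arguments.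
Unset Strict Implicit.
Variable F : fieldType.
Local Notation RF := (RF F).

Lemma liftPM p q r (M : 'M[{poly F}]_(p, q)) (N : 'M_(q, r)) :
  liftP (M *m N) = liftP M *m liftP N.
Proof. exact: map_mxM. Qed.

Lemma liftPD p q (M N : 'M[{poly F}]_(p, q)) : liftP (M + N) = liftP M + liftP N.
Proof. exact: map_mxD. Qed.

Lemma liftPN p q (M : 'M[{poly F}]_(p, q)) : liftP (- M) = - liftP M.
Proof. exact: map_mxN. Qed.

Lemma liftPZ p q a (M : 'M[{poly F}]_(p, q)) : liftP (a *: M) = a%:F *: liftP M.
Proof. exact: map_mxZ. Qed.

Lemma liftP0 p q : liftP (0 : 'M[{poly F}]_(p, q)) = 0.
Proof. exact: map_mx0. Qed.

Lemma liftP1 p : liftP (1%:M : 'M[{poly F}]_p) = 1%:M.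
Proof. exact: map_mx1. Qed.

Lemma liftP_tr p q (M : 'M[{poly F}]_(p, q)) : liftP M^T = (liftP M)^T.
Proof. by rewrite /liftP map_trmx. Qed.

Lemma liftP_col p1 p2 q (M : 'M[{poly F}]_(p1, q)) (N : 'M_(p2, q)) :
  liftP (col_mx M N) = col_mx (liftP M) (liftP N).
Proof. exact: map_col_mx. Qed.

Lemma liftP_row p q1 q2 (M : 'M[{poly F}]_(p, q1)) (N : 'M_(p, q2)) :
  liftP (row_mx M N) = row_mx (liftP M) (liftP N).
Proof. exact: map_row_mx. Qed.

Lemma liftP_inj p q : injective (@liftP F p q).
Proof.
move=> M N /matrixP eMN; apply/matrixP => i j.
by move: (eMN i j); rewrite !mxE => /eqP; rewrite tofrac_eq => /eqP.
Qed.

Lemma liftCE p q (M : 'M[F]_(p, q)) : liftC M = liftP (polyM M).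
Proof. by apply/matrixP => i j; rewrite !mxE. Qed.

Lemma polyMM p q r (M : 'M[F]_(p, q)) (N : 'M_(q, r)) :
  polyM (M *m N) = polyM M *m polyM N.
Proof. exact: map_mxM. Qed.

Lemma polyMD p q (M N : 'M[F]_(p, q)) : polyM (M + N) = polyM M + polyM N.
Proof. exact: map_mxD. Qed.

Lemma polyMN p q (M : 'M[F]_(p, q)) : polyM (- M) = - polyM M.
Proof. exact: map_mxN. Qed.

Lemma polyM1 p : polyM (1%:M : 'M[F]_p) = 1%:M.
Proof. exact: map_mx1. Qed.

Lemma polyM_tr p q (M : 'M[F]_(p, q)) : polyM M^T = (polyM M)^T.
Proof. by rewrite /polyM map_trmx. Qed.

Lemma liftCM p q r (M : 'M[F]_(p, q)) (N : 'M_(q, r)) :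
  liftC (M *m N) = liftC M *m liftC N.
Proof. by rewrite !liftCE polyMM liftPM. Qed.

Lemma liftC1 p : liftC (1%:M : 'M[F]_p) = 1%:M.
Proof. by rewrite liftCE polyM1 liftP1. Qed.

Lemma liftC_tr p q (M : 'M[F]_(p, q)) : liftC M^T = (liftC M)^T.
Proof. by rewrite !liftCE polyM_tr liftP_tr. Qed.

Lemma polyM_unit p (M : 'M[F]_p) : M \in unitmx -> polyM M \in unitmx.
Proof. by move=> uM; rewrite map_unitmx. Qed.

Lemma polyM_inv p (M : 'M[F]_p) : polyM (invmx M) = invmx (polyM M).
Proof. exact: map_invmx. Qed.

Lemma liftC_unit p (M : 'M[F]_p) : M \in unitmx -> liftC M \in unitmx.
Proof.
move=> uM; apply: (proj1 (@mulmx1_unit _ _ _ (liftC (invmx M)) _)).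
by rewrite -liftCM mulmxV // liftC1.
Qed.

Lemma liftC_inv p (M : 'M[F]_p) : M \in unitmx -> liftC (invmx M) = invmx (liftC M).
Proof.
move=> uM; have uM' := liftC_unit uM.
by rewrite -[LHS]mulmx1 -(mulmxV uM') mulmxA -liftCM mulVmx // liftC1 mul1mx.
Qed.

Definition is_poly p q (M : 'M[RF]_(p, q)) := exists N, M = liftP N.

Lemma is_poly_lift p q (N : 'M[{poly F}]_(p, q)) : is_poly (liftP N).
Proof. by exists N. Qed.

Lemma is_polyC p q (N : 'M[F]_(p, q)) : is_poly (liftC N).
Proof. by exists (polyM N); rewrite liftCE. Qed.

Lemma is_polyD p q (M N : 'M[RF]_(p, q)) : is_poly M -> is_poly N -> is_poly (M + N).
Proof. by move=> [M' ->] [N' ->]; exists (M' + N'); rewrite liftPD. Qed.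

Lemma is_polyN p q (M : 'M[RF]_(p, q)) : is_poly M -> is_poly (- M).
Proof. by move=> [M' ->]; exists (- M'); rewrite liftPN. Qed.

Lemma is_polyM p q r (M : 'M[RF]_(p, q)) (N : 'M_(q, r)) :
  is_poly M -> is_poly N -> is_poly (M *m N).
Proof. by move=> [M' ->] [N' ->]; exists (M' *m N'); rewrite liftPM. Qed.

Lemma is_polyX p q (M : 'M[RF]_(p, q)) : is_poly M -> is_poly (lamF F *: M).
Proof. by move=> [M' ->]; exists ('X *: M'); rewrite liftPZ. Qed.

Lemma is_poly_tr p q (M : 'M[RF]_(p, q)) : is_poly M -> is_poly M^T.
Proof. by move=> [M' ->]; exists M'^T; rewrite liftP_tr. Qed.

Lemma is_poly_col p1 p2 q (M : 'M[RF]_(p1, q)) (N : 'M_(p2, q)) :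
  is_poly M -> is_poly N -> is_poly (col_mx M N).
Proof.
by move=> [M' ->] [N' ->]; exists (col_mx M' N'); rewrite liftP_col.
Qed.

End Lifting.

(** * Polynomial bases of null spaces and transfer of minimality *)

Section Bases.
Set Implicit Arguments.
Unset Strict Implicit.
Variable F : fieldType.
Local Notation RF := (RF F).

(** Each basis lies in the span of the other, so the ranks agree. Competing bases then undergo the
    same total degree shift [r * d]. *)
Lemma right_poly_basis_size p q (G : 'M[RF]_(p, q)) r r'
    (N : 'M[{poly F}]_(q, r)) (N' : 'M[{poly F}]_(q, r')) :
  right_poly_basis G N -> right_poly_basis G N' -> r = r'.
Proof.
have le r1 r2 (N1 : 'M[{poly F}]_(q, r1)) (N2 : 'M[{poly F}]_(q, r2)) :
    right_poly_basis G N1 -> right_poly_basis G N2 -> (r1 <= r2)%N.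
  move=> [GN1 /eqP fN1 _] [_ /eqP fN2 span]; rewrite -fN1 -{1}fN2.
  apply: mxrankS; apply/row_subP => i.
  have /span[c Ec] : G *m (row i (liftP N1)^T)^T = 0.
    by rewrite -tr_col trmxK colE mulmxA GN1 mul0mx.
  by rewrite -[row i _]trmxK Ec trmx_mul submxMl.
by move=> bN bN'; apply/eqP; rewrite eqn_leq (le _ _ N N') // (le _ _ N' N).
Qed.

(** Bounding sizes by [d.+1] covers zero entries, of size 0, without a separate case. *)
Lemma coldeg_leP q r (N : 'M[{poly F}]_(q, r)) j d :
  reflect (forall i, (size (N i j) <= d.+1)%N) (coldeg N j <= d)%N.
Proof.
apply: (iffP (bigmax_leqP _ _ _)) => [le i|le i _].
  by move: (le i isT); case: (size _).
by move: (le i); case: (size _).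
Qed.

Lemma size_le_coldeg q r (N : 'M[{poly F}]_(q, r)) i j :
  (size (N i j) <= (coldeg N j).+1)%N.
Proof. exact/coldeg_leP. Qed.

(* [f] and [g] restrict to inverse bijections between the right null spaces of
   [L] and [G], preserving polynomial vectors and shifting degrees by [d]. *)
Record kernel_iso p q p' q' d (G : 'M[RF]_(p, q)) (L : 'M[RF]_(p', q'))
    (f : 'M[{poly F}]_(q, q')) (g : 'M[RF]_(q', q)) : Prop := KernelIso {
  kernel_iso_projK : liftP f *m g = 1%:M;
  kernel_iso_liftK : forall r (x : 'M[RF]_(q', r)),
    L *m x = 0 -> x = g *m (liftP f *m x);
  kernel_iso_proj : forall r (x : 'M[RF]_(q', r)),
    L *m x = 0 -> G *m (liftP f *m x) = 0;
  kernel_iso_lift : forall r (y : 'M[RF]_(q, r)), G *m y = 0 -> L *m (g *m y) = 0;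
  kernel_iso_poly : forall r (y : 'M[{poly F}]_(q, r)),
    G *m liftP y = 0 -> is_poly (g *m liftP y);
  kernel_iso_deg : forall r (N : 'M[{poly F}]_(q', r)) j,
    L *m liftP N = 0 -> col j (f *m N) != 0 -> coldeg N j = (coldeg (f *m N) j + d)%N
}.

Section Transfer.
Variables (p q p' q' d : nat) (G : 'M[RF]_(p, q)) (L : 'M[RF]_(p', q')).
Variables (f : 'M[{poly F}]_(q, q')) (g : 'M[RF]_(q', q)).
Hypothesis isoGL : kernel_iso d G L f g.

Let fg1 := kernel_iso_projK isoGL.
Let gfK := kernel_iso_liftK isoGL.
Let kerG := kernel_iso_proj isoGL.
Let kerL := kernel_iso_lift isoGL.
Let polyg := kernel_iso_poly isoGL.
Let degf := kernel_iso_deg isoGL.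

(** Independence survives because [g] recovers [N] from [f *m N], so the rank cannot drop. For
    spanning, lift a null vector of [G] by [g], expand it in [N] and project back. *)
Lemma transfer_proj_basis r (N : 'M[{poly F}]_(q', r)) :
  right_poly_basis L N -> right_poly_basis G (f *m N).
Proof.
move=> [LN0 fN span]; split; first by rewrite liftPM kerG.
  rewrite /row_free eqn_leq rank_leq_row /=; move/eqP: fN => {1}<-.
  by rewrite {1}(gfK LN0) -liftPM trmx_mul mxrankM_maxl.
move=> y Gy0; have /span[c Ec] := kerL Gy0.
by exists c; rewrite liftPM -mulmxA -Ec mulmxA fg1 mul1mx.
Qed.

Lemma transfer_proj_lift r (N : 'M[{poly F}]_(q, r)) (N' : 'M[{poly F}]_(q', r)) :
  liftP N' = g *m liftP N -> f *m N' = N.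
Proof.
by move=> EN'; apply: liftP_inj; rewrite liftPM EN' mulmxA fg1 mul1mx.
Qed.

Lemma transfer_lift_basis r (N : 'M[{poly F}]_(q, r)) (N' : 'M[{poly F}]_(q', r)) :
  liftP N' = g *m liftP N -> right_poly_basis G N -> right_poly_basis L N'.
Proof.
move=> EN' [GN0 fN span]; split; first by rewrite EN' kerL.
  rewrite /row_free eqn_leq rank_leq_row /=; move/eqP: fN => {1}<-.
  by rewrite -(transfer_proj_lift EN') liftPM trmx_mul mxrankM_maxl.
move=> x Lx0; have /span[c Ec] := kerG Lx0.
by exists c; rewrite EN' -mulmxA -Ec -gfK.
Qed.

Lemma transfer_coldeg r (N : 'M[{poly F}]_(q', r)) j :
  right_poly_basis L N -> coldeg N j = (coldeg (f *m N) j + d)%N.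
Proof.
move=> bN; have [LN0 _ _] := bN; apply: degf => //.
have [_ fr _] := transfer_proj_basis bN.
(* A zero column [j] would make the entry [(j, j)] of the product with a right inverse equal to 0
   instead of 1. *)
apply: contraL fr => /eqP c0; apply/negP => /row_freeP[X EX].
have /matrixP/(_ j j)/eqP := EX; rewrite !mxE eqxx big1 ?(eq_sym 0) ?oner_eq0 //.
by move=> i _; move/matrixP/(_ i 0): c0; rewrite !mxE => ->; rewrite tofrac0 mul0r.
Qed.

Lemma transfer_totdeg r (N : 'M[{poly F}]_(q', r)) :
  right_poly_basis L N -> totdeg N = (totdeg (f *m N) + r * d)%N.
Proof.
move=> bN; rewrite /totdeg (eq_bigr _ (fun j _ => transfer_coldeg j bN)).
by rewrite big_split /= sum_nat_const card_ord.
Qed.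

(** A competing basis of [G] lifts to a polynomial basis of [L]; both total degrees rise by the same
    amount, so the comparison made in [L] descends to [G]. *)
Lemma transfer_minimal_proj r (N : 'M[{poly F}]_(q', r)) :
  right_minimal_basis L N -> right_minimal_basis G (f *m N).
Proof.
move=> [bN minN]; have bfN := transfer_proj_basis bN; split=> // r' N1 bN1.
have [GN1 _ _] := bN1; have [N2 EN2] := polyg GN1.
have bN2 := transfer_lift_basis (esym EN2) bN1.
have := minN _ _ bN2; rewrite !transfer_totdeg //.
have -> : (r * d = r' * d)%N by rewrite (right_poly_basis_size bfN bN1).
by rewrite (transfer_proj_lift (esym EN2)) leq_add2r.
Qed.

Lemma transfer_minimal_lift r (N : 'M[{poly F}]_(q, r)) (N' : 'M[{poly F}]_(q', r)) :
  liftP N' = g *m liftP N -> right_minimal_basis G N -> right_minimal_basis L N'.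
Proof.
move=> EN' [bN minN]; have bN' := transfer_lift_basis EN' bN; split=> // r1 N1 bN1.
have bfN1 := transfer_proj_basis bN1.
rewrite !transfer_totdeg // (transfer_proj_lift EN').
have -> : (r1 * d = r * d)%N by rewrite (right_poly_basis_size bN bfN1).
by rewrite leq_add2r minN.
Qed.

Lemma sort_map_addn e s : sort leq (map (addn e) s) = map (addn e) (sort leq s).
Proof.
apply: (sorted_eq leq_trans anti_leq); first exact: (sort_sorted leq_total).
  rewrite sorted_map; have := sort_sorted leq_total s; apply: sub_sorted.
  by move=> a b /=; rewrite leq_add2l.
by rewrite perm_sort perm_map // perm_sym perm_sort.
Qed.

(** Lifting a minimal basis of [G] gives existence; projecting an arbitrary minimal basis of [L]
    gives uniqueness. *)
Lemma transfer_minimal_indices s :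
  right_min_indices G s -> right_min_indices L (map (addn d) s).
Proof.
have degs r (N : 'M[{poly F}]_(q', r)) : right_poly_basis L N ->
    col_degs N = map (addn d) (col_degs (f *m N)).
  move=> bN; rewrite /col_degs -map_comp; apply: eq_map => j /=.
  by rewrite (transfer_coldeg j bN) addnC.
move=> [[r [N [mN <-]]] uniq_s]; split; last first.
  move=> r' N' mN'; have [bN' _] := mN'.
  by rewrite degs // sort_map_addn (uniq_s _ _ (transfer_minimal_proj mN')) // uniq_s.
have [[GN0 _ _] _] := mN; have [N' EN'] := polyg GN0.
have mN' := transfer_minimal_lift (esym EN') mN.
exists r, N'; split=> //; have [bN' _] := mN'.
by rewrite degs // sort_map_addn (transfer_proj_lift (esym EN')).
Qed.

End Transfer.
End Bases.

(** * Minimal realizations are observable *)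

Section Realizations.
Set Implicit Arguments.
Unset Strict Implicit.
Variable F : fieldType.
Local Notation RF := (RF F).

Lemma liftP_pencil n (A : 'M[F]_n) :
  liftP ('X%:M - polyM A) = (lamF F)%:M - liftC A.
Proof. by rewrite liftPD liftPN liftCE {1}/liftP map_scalar_mx. Qed.

(** The determinant is the characteristic polynomial of [A], which is monic and hence nonzero. *)
Lemma pencil_unit n (A : 'M[F]_n) : (lamF F)%:M - liftC A \in unitmx.
Proof.
rewrite -liftP_pencil unitmxE /liftP det_map_mx unitfE tofrac_eq0.
exact: monic_neq0 (char_poly_monic A).
Qed.

Lemma resolventK n (A : 'M[F]_n) r (x : 'M_(n, r)) :
  resolvent A *m (((lamF F)%:M - liftC A) *m x) = x.
Proof. by rewrite mulmxA mulVmx ?mul1mx ?pencil_unit. Qed.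

Lemma mulmx_resolvent n (A : 'M[F]_n) r (x : 'M_(n, r)) :
  ((lamF F)%:M - liftC A) *m (resolvent A *m x) = x.
Proof. by rewrite mulmxA mulmxV ?mul1mx ?pencil_unit. Qed.

Lemma resolvent_tr n (A : 'M[F]_n) : resolvent A^T = (resolvent A)^T.
Proof.
by rewrite /resolvent trmx_inv linearB /= tr_scalar_mx liftC_tr.
Qed.

Lemma transfer_tr n m (A : 'M[F]_n) (B : 'M_(n, m)) (C : 'M_(m, n)) :
  transfer A^T C^T B^T = (transfer A B C)^T.
Proof. by rewrite /transfer resolvent_tr !liftC_tr !trmx_mul mulmxA. Qed.

(** By this duality the observability argument also serves for left null vectors. *)
Lemma minimal_realization_tr n m (A : 'M[F]_n) (B : 'M_(n, m)) (C : 'M_(m, n)) :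
  minimal_realization A B C -> minimal_realization A^T C^T B^T.
Proof.
move=> minA n' A' B' C'; rewrite transfer_tr => /(congr1 trmx); rewrite trmxK.
by rewrite -transfer_tr; apply: minA.
Qed.

(* An output map [C] whose row space lies in an [A]-stable subspace [V]
   can be realized with [\rank V] states, by restricting [A] to [V]. *)
Lemma minimal_realization_full n m (A : 'M[F]_n) (B : 'M_(n, m)) (C : 'M_(m, n))
    p (V : 'M[F]_(p, n)) :
  minimal_realization A B C -> (C <= V)%MS -> (V *m A <= V)%MS -> row_full V.
Proof.
move=> minA CV VA; have := CV; rewrite -(eq_row_base V) => /submxP[C' EC].
have /submxP[A' EA] : (row_base V *m A <= row_base V)%MS.
  by rewrite (eqmxMr A (eq_row_base V)) eq_row_base.
rewrite /row_full eqn_leq rank_leq_col /=.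
apply: (minA _ A' (row_base V *m B) C').
(* With [V] the row base, [V A = A' V] makes [V] intertwine the two resolvents, so the restricted
   system has the same transfer function. *)
have resP : resolvent A' *m liftC (row_base V) = liftC (row_base V) *m resolvent A.
  rewrite -[RHS](resolventK A'); congr (_ *m _).
  rewrite [RHS]mulmxA mulmxBl mul_scalar_mx -liftCM -EA liftCM.
  rewrite -mul_mx_scalar -mulmxBr -(mulmxA (liftC (row_base V))).
  by rewrite mulmxV ?pencil_unit // mulmx1.
rewrite /transfer EC (liftCM (row_base V) B) (liftCM C') !mulmxA.
by rewrite -(mulmxA _ (resolvent A')) resP !mulmxA.
Qed.

(* The matrices [W] with [W x] polynomial contain [C] and are stable under right
   multiplication by [A], since [W A x = X W x - W (X - A) x]. *)
Lemma observable_poly n m (A : 'M[F]_n) (B : 'M_(n, m)) (C : 'M_(m, n))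
    r (x : 'M[RF]_(n, r)) :
  minimal_realization A B C ->
  is_poly (((lamF F)%:M - liftC A) *m x) -> is_poly (liftC C *m x) -> is_poly x.
Proof.
move=> minA poly_x poly_Cx.
pose good p (W : 'M[F]_(p, n)) := is_poly (liftC W *m x).
have goodM p p' (W : 'M_(p, n)) (K : 'M_(p', p)) : good _ W -> good _ (K *m W).
  by move=> gW; rewrite /good liftCM -mulmxA; apply: is_polyM gW; apply: is_polyC.
have goodS p p' (W : 'M_(p, n)) (W' : 'M_(p', n)) : (W' <= W)%MS -> good _ W -> good _ W'.
  by move=> /submxP[K ->]; apply: goodM.
have goodA p (W : 'M_(p, n)) : good _ W -> good _ (W *m A).
  move=> gW; rewrite /good; have -> : liftC (W *m A) *m x =
      lamF F *: (liftC W *m x) - liftC W *m (((lamF F)%:M - liftC A) *m x).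
    rewrite mulmxBl mulmxBr mul_scalar_mx -scalemxAr opprB addrCA subrr addr0.
    by rewrite liftCM mulmxA.
  by apply: is_polyD; [apply: is_polyX | apply/is_polyN/is_polyM => //; apply: is_polyC].
have goodD p p' (W : 'M_(p, n)) (W' : 'M_(p', n)) :
    good _ W -> good _ W' -> good _ (W + W')%MS.
  move=> gW gW'; apply: (goodS _ _ (col_mx W W')); first by rewrite addsmxE.
  by rewrite /good !liftCE /liftP /polyM !map_col_mx mul_col_mx; apply: is_poly_col;
    rewrite -/(polyM _) -/(liftP _) -liftCE.
(* Induction on the codimension of [W]: either [W + C + W A] is contained in [W], which is then
   stable and contains [C], or the rank strictly increases. *)
have grow d : forall W : 'M[F]_n, (n - \rank W <= d)%N -> good _ W ->
    exists V : 'M[F]_n, [/\ good _ V, (C <= V)%MS & (V *m A <= V)%MS].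
  elim: d => [|d IHd] W.
    rewrite leqn0 subn_eq0 => fW gW; exists W.
    by split=> //; apply: submx_full; rewrite /row_full eqn_leq rank_leq_col.
  move=> ledW gW; pose W' := (W + (C + W *m A))%MS.
  have gW' : good _ W' by apply: (goodD _ _ _ _ gW (goodD _ _ _ _ poly_Cx (goodA _ _ gW))).
  have [W'W | W'W] := boolP (W' <= W)%MS.
    exists W; split=> //; apply: submx_trans W'W.
      by rewrite (submx_trans (addsmxSl C (W *m A))) ?addsmxSr.
    by rewrite (submx_trans (addsmxSr C (W *m A))) ?addsmxSr.
  apply: (IHd W') => //; have : (W < W')%MS by rewrite ltmxE addsmxSl.
  rewrite ltmxErank => /andP[_ ltW]; rewrite -ltnS; apply: leq_trans ledW.
  by rewrite ltn_sub2l // (leq_trans ltW) ?rank_leq_col.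
have good0 : good _ (0 : 'M[F]_n).
  by exists 0; rewrite liftCE /polyM map_mx0 liftP0 mul0mx liftP0.
have [V [gV CV VA]] := grow n 0 (leq_subr _ _) good0.
(* Full rank gives [K V = 1], so the identity is itself a good matrix. *)
have /row_fullP[K KV] := minimal_realization_full minA CV VA.
by have := goodM _ _ _ K gV; rewrite /good KV liftC1 mul1mx.
Qed.

End Realizations.

(** * Block vectors and Kronecker products with the identity *)

Section Blocks.
Set Implicit Arguments.
Unset Strict Implicit.

Lemma nth_allpairs (T1 T2 T3 : Type) (f : T1 -> T2 -> T3) x1 x2 x3 s t i j :
  (i < size s)%N -> (j < size t)%N ->
  nth x3 (allpairs f s t) (i * size t + j) = f (nth x1 s i) (nth x2 t j).
Proof.
move=> + ltj; elim: s i => //= a s IHs [|i] lti.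
  by rewrite nth_cat size_map mul0n add0n ltj (nth_map x2).
by rewrite nth_cat size_map mulSn -addnA ltnNge leq_addr /= addKn IHs.
Qed.

(** [mxvec_index] is a rank in an enumeration of pairs; its explicit row-major value is what locates
    blocks inside the cast [col_mx] of [lastblk]. *)
Lemma mxvec_index_val m n (i : 'I_m) (j : 'I_n) :
  mxvec_index i j = (i * n + j)%N :> nat.
Proof.
pose e := enum {: 'I_m * 'I_n}.
have Ee : e = [seq (i, j) | i <- enum 'I_m, j <- enum 'I_n].
  by rewrite /e enumT unlock.
have lt_ij : (i * n + j < size e)%N.
  rewrite -cardE card_prod !card_ord (leq_trans (n := i.+1 * n)) ?leq_mul2r ?ltn_ord ?orbT //.
  by rewrite mulSn addnC ltn_add2r.
apply/eqP; rewrite -(nth_uniq (i, j) _ lt_ij (enum_uniq _)); last first.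
  by rewrite /= -cardE ltn_ord.
rewrite nth_enum_rank -/e Ee.
have := @nth_allpairs _ _ _ pair i j (i, j) (enum 'I_m) (enum 'I_n) i j.
by rewrite !size_enum_ord !nth_ord_enum => ->.
Qed.

Lemma mxvec_index_inj m n (i i' : 'I_m) (j j' : 'I_n) :
  mxvec_index i j = mxvec_index i' j' -> (i, j) = (i', j').
Proof. by move/cast_ord_inj/enum_rank_inj. Qed.

(** Evaluates, at a known index, the dependent matches by which [kron], [blockT_row] and [mD] are
    defined. *)
Lemma mxvec_indexPE T m n (f : 'I_m -> 'I_n -> T) i j :
  match mxvec_indexP (mxvec_index i j) return T with
    isMxvecIndex i' j' => f i' j' end = f i j.
Proof.
move Ek: (mxvec_index i j) => k; case: k / (mxvec_indexP k) Ek => i' j'.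
by case/mxvec_index_inj=> -> ->.
Qed.

Lemma sum_mxvec_index (V : nmodType) m n (f : 'I_(m * n) -> V) :
  \sum_u f u = \sum_i \sum_j f (mxvec_index i j).
Proof.
rewrite pair_bigA (reindex _ (curry_mxvec_bij m n)) /=.
by apply: eq_bigr => [[i j]].
Qed.

(** Same formula as [rblock], but over any coefficients, since blocks are also taken over the
    fraction field. *)
Definition blk (R : Type) m k r (x : 'M[R]_(k * m, r)) (i : 'I_k) : 'M[R]_(m, r) :=
  \matrix_(a, c) x (mxvec_index i a) c.

Lemma blk_inj (R : Type) m k r (x y : 'M[R]_(k * m, r)) :
  (forall i, blk x i = blk y i) -> x = y.
Proof.
move=> Exy; apply/matrixP => u c; case/mxvec_indexP: u => i a.
by have /matrixP/(_ a c) := Exy i; rewrite !mxE.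
Qed.

Lemma blk_map (R R' : Type) (h : R -> R') m k r (x : 'M[R]_(k * m, r)) i :
  blk (map_mx h x) i = map_mx h (blk x i).
Proof. by apply/matrixP=> a c; rewrite !mxE. Qed.

Section BlocksRing.
Variable R : nzRingType.
Implicit Types (m k r : nat).

Lemma blkD m k r (x y : 'M[R]_(k * m, r)) i : blk (x + y) i = blk x i + blk y i.
Proof. by apply/matrixP=> a c; rewrite !mxE. Qed.

Lemma blkN m k r (x : 'M[R]_(k * m, r)) i : blk (- x) i = - blk x i.
Proof. by apply/matrixP=> a c; rewrite !mxE. Qed.

Lemma blk0 m k r i : blk (0 : 'M[R]_(k * m, r)) i = 0.
Proof. by apply/matrixP=> a c; rewrite !mxE. Qed.

Lemma blkM m k p r (x : 'M[R]_(k * m, p)) (y : 'M_(p, r)) i :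
  blk (x *m y) i = blk x i *m y.
Proof. by apply/matrixP=> a c; rewrite !mxE; apply: eq_bigr => j _; rewrite !mxE. Qed.

Lemma kronE a b c d (P : 'M[R]_(a, b)) (Q : 'M_(c, d)) i1 i2 j1 j2 :
  kron P Q (mxvec_index i1 i2) (mxvec_index j1 j2) = P i1 j1 * Q i2 j2.
Proof.
rewrite mxE (mxvec_indexPE (fun i i' => match mxvec_indexP (mxvec_index j1 j2)
  return R with isMxvecIndex j j' => P i j * Q i' j' end)).
by rewrite (mxvec_indexPE (fun j j' => P i1 j * Q i2 j')).
Qed.

Lemma blk_kron1 a b m r (P : 'M[R]_(a, b)) (x : 'M_(b * m, r)) i :
  blk (kron P 1%:M *m x) i = \sum_j P i j *: blk x j.
Proof.
apply/matrixP=> u c; rewrite !mxE summxE sum_mxvec_index.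
apply: eq_bigr => j _; rewrite (bigD1 u) //= big1 ?addr0 => [|v /negPf nvu].
  by rewrite kronE !mxE eqxx mulr1.
by rewrite kronE !mxE eq_sym nvu mulr0 mul0r.
Qed.

(** Phrased as an action on a block vector, so that it can be checked block by block with
    [blk_kron1]. *)
Lemma kron1M a b c m r (P : 'M[R]_(a, b)) (Q : 'M_(b, c)) (x : 'M_(c * m, r)) :
  kron P 1%:M *m (kron Q 1%:M *m x) = kron (P *m Q) (1%:M : 'M_m) *m x.
Proof.
apply: blk_inj => i; rewrite !blk_kron1.
under eq_bigr do rewrite blk_kron1 scaler_sumr.
rewrite exchange_big /=; apply: eq_bigr => l _; rewrite mxE scaler_suml.
by apply: eq_bigr => j _; rewrite scalerA.
Qed.

Lemma kron11 a m r (x : 'M[R]_(a * m, r)) : kron 1%:M (1%:M : 'M_m) *m x = x.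
Proof.
apply: blk_inj => i; rewrite blk_kron1 (bigD1 i) //= big1 => [|j /negPf nij].
  by rewrite mxE eqxx scale1r addr0.
by rewrite mxE eq_sym nij scale0r.
Qed.

Lemma kron1D a b m r (P Q : 'M[R]_(a, b)) (x : 'M_(b * m, r)) :
  kron (P + Q) (1%:M : 'M_m) *m x = kron P 1%:M *m x + kron Q 1%:M *m x.
Proof.
apply: blk_inj => i; rewrite blkD !blk_kron1 -big_split.
by apply: eq_bigr => j _; rewrite mxE scalerDl.
Qed.

Lemma kron1_tr a b m (P : 'M[R]_(a, b)) : (kron P (1%:M : 'M_m))^T = kron P^T 1%:M.
Proof.
apply/matrixP => u v; case/mxvec_indexP: u => j j'; case/mxvec_indexP: v => i i'.
by rewrite mxE !kronE !mxE eq_sym.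
Qed.

Lemma blk_blockT_row m k (Q : 'M[R]_(m, k * m)) i :
  blk (blockT_row Q) i = \matrix_(a, s) Q a (mxvec_index i s).
Proof.
apply/matrixP=> a s; rewrite !mxE.
by rewrite (mxvec_indexPE (fun i a => Q a (mxvec_index i s))).
Qed.

Definition colblk m k r (X : 'I_k -> 'M[R]_(m, r)) : 'M_(k * m, r) :=
  \matrix_(u, c) match mxvec_indexP u with isMxvecIndex i a => X i a c end.

Lemma colblkK m k r (X : 'I_k -> 'M[R]_(m, r)) i : blk (colblk X) i = X i.
Proof.
by apply/matrixP=> a c; rewrite !mxE (mxvec_indexPE (fun i a => X i a c)).
Qed.

Lemma mul_tr_blk m k p r (x : 'M[R]_(k * m, p)) (y : 'M_(k * m, r)) :
  x^T *m y = \sum_i (blk x i)^T *m blk y i.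
Proof.
apply/matrixP=> u c; rewrite !mxE summxE sum_mxvec_index.
by apply: eq_bigr => j _; rewrite mxE; apply: eq_bigr => v _; rewrite !mxE.
Qed.

End BlocksRing.

Lemma map_kron1 (R R' : nzRingType) (h : {rmorphism R -> R'}) a b m (P : 'M[R]_(a, b)) :
  map_mx h (kron P (1%:M : 'M_m)) = kron (map_mx h P) 1%:M.
Proof.
apply/matrixP => u v; rewrite mxE.
case/mxvec_indexP: u => i i'; case/mxvec_indexP: v => j j'.
by rewrite !kronE !mxE rmorphM rmorph_nat.
Qed.

Lemma blk_lastblk (F : fieldType) m k1 r (X : 'M[{poly F}]_(m, r)) i :
  blk (lastblk k1 X) i = if i == ord_max then X else 0.
Proof.
apply/matrixP=> a c; rewrite mxE /lastblk castmxE /= cast_ord_id esymK.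
case: eqP => [->|ni].
  rewrite -[RHS](col_mxEd (0 : 'M_(k1 * m, r))); congr (col_mx _ _ _ _).
  by apply: val_inj; exact: mxvec_index_val.
(* A block before the last one lies entirely in the zero part of the [col_mx]. *)
have lti : (i * m + a < k1 * m)%N.
  have ltik : (i < k1)%N.
    rewrite ltn_neqAle -ltnS ltn_ord andbT; apply/eqP => Ei; case: ni.
    exact: val_inj.
  rewrite (leq_trans (n := i.+1 * m)) ?leq_mul2r ?ltik ?orbT //.
  by rewrite mulSn addnC ltn_add2r.
rewrite [LHS](_ : _ = (col_mx (0 : 'M_(k1 * m, r)) X) (lshift m (Ordinal lti)) c).
  by rewrite col_mxEu !mxE.
by congr (col_mx _ _ _ _); apply: val_inj; exact: mxvec_index_val.
Qed.

End Blocks.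

(** * The three-term recurrence *)

(** The size [K] is a variable so that the cast disappears by case analysis on [e]. The inverse of
    [[M; d]] splits into its first [k] columns [Q] and its last column [q]. *)
Lemma invmx_col_cast (R : comUnitRingType) k K (e : (k + 1)%N = K)
    (M : 'M[R]_(k, K)) (d : 'M_(1, K)) :
  let Y := castmx (e, erefl) (col_mx M d) in
  let Q := invmx Y *m castmx (e, erefl) (col_mx 1%:M 0) in
  Y \in unitmx ->
  [/\ M *m Q = 1%:M, d *m Q = 0 & exists q, Q *m M + q *m d = 1%:M].
Proof.
case: K / e M d => M d; rewrite /= !castmx_id => uY.
have /esym := mulKVmx uY (col_mx 1%:M 0 : 'M_(k + 1, k)).
rewrite mul_col_mx => /eq_col_mx[MQ dQ]; split=> //.
exists (invmx (col_mx M d) *m col_mx 0 1%:M); rewrite -!mulmxA -mulmxDr.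
by rewrite !mul_col_mx !mul0mx !mul1mx add_col_mx add0r addr0 mulVmx.
Qed.

Section ThreeTermRecurrence.
Set Implicit Arguments.
Unset Strict Implicit.
Variables (F : fieldType) (al be ga : nat -> F).
Hypothesis al_neq0 : forall j, al j != 0.
Local Notation RF := (RF F).
Local Notation phi := (phi al be ga).
Local Notation MPhi := (MPhi al be ga).

(** Shifted index with the convention phi_(-1) = 0. *)
Definition phi_prev j : {poly F} := if j is j'.+1 then phi j' else 0.

Lemma phi2E j : phi2 al be ga j = (phi_prev j, phi j).
Proof. by case: j => [|j] //=; rewrite /Defs.phi /=; case: (phi2 _ _ _ j). Qed.

Lemma phiS j :
  phi j.+1 = (al j)^-1 *: (('X - (be j)%:P) * phi j - ga j *: phi_prev j).
Proof. by rewrite {1}/Defs.phi /= phi2E. Qed.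

Lemma size_phi j : size (phi j) = j.+1.
Proof.
(* The recurrence reaches back two indices; the bound on the earlier polynomial shows that it cannot
   affect the leading term. *)
suff: size (phi j) = j.+1 /\ (size (phi_prev j) <= j)%N by case.
elim: j => [|j [szj szp]]; first by rewrite size_poly0 size_poly1.
split; last by rewrite szj.
have phij0 : phi j != 0 by rewrite -size_poly_gt0 szj.
have szM : size (('X - (be j)%:P) * phi j) = j.+2.
  by rewrite size_mul ?polyXsubC_eq0 // size_XsubC szj.
rewrite phiS size_scale ?invr_eq0 // size_polyDl szM //.
by rewrite size_polyN (leq_ltn_trans (size_scale_leq _ _)) // ltnS ltnW.
Qed.

Definition phi_col k1 : 'cV[{poly F}]_k1.+1 := \col_i phi (k1 - i).

Lemma sum_eq_ord K a (c : {poly F}) (f : nat -> {poly F}) :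
  \sum_(j < K) (if j == a :> nat then c else 0) * f j = if (a < K)%N then c * f a else 0.
Proof.
case: ltnP => [ltaK|leKa].
  rewrite (bigD1 (Ordinal ltaK)) //= eqxx big1 ?addr0 // => j.
  by rewrite -val_eqE /= => /negPf ->; rewrite mul0r.
by rewrite big1 // => j _; rewrite ltn_eqF ?mul0r // (leq_trans (ltn_ord j)).
Qed.

(** Row [i] is the three-term recurrence at index [t = k1 - 1 - i]. *)
Lemma MPhi_phi k1 : MPhi k1 *m phi_col k1 = 0.
Proof.
apply/matrixP => i z; rewrite !mxE; set t := (k1 - 1 - i)%N.
have Ei : (k1 = t + i.+1)%N by rewrite /t; have := ltn_ord i; lia.
pose c a x (j : 'I_k1.+1) : {poly F} := (if j == a :> nat then x else 0) * phi (k1 - j).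
rewrite (eq_bigr (fun j => c i (- (al t)%:P) j + c i.+1 ('X - (be t)%:P) j
  + c i.+2 (- (ga t)%:P) j)); last first.
  move=> j _; rewrite !mxE /c -/t -!mulrDl; congr (_ * _).
  case: eqP => [->|_]; first by rewrite !ltn_eqF // !addr0.
  case: eqP => [->|_]; first by rewrite ltn_eqF // add0r addr0.
  by rewrite !add0r.
rewrite !big_split /= !(sum_eq_ord _ _ _ (fun j => phi (k1 - j))).
rewrite ltnS ltnW // !ltnS ltn_ord.
have -> : (k1 - i = t.+1)%N by lia.
have -> : (k1 - i.+1 = t)%N by lia.
rewrite {1}phiS mulNr mul_polyC scalerA mulfV // scale1r.
(* In the last row the [ga] entry falls outside the matrix; there [t = 0], and [phi_prev 0 = 0]
   matches. *)
have -> : (if (i.+1 < k1)%N then - (ga t)%:P * phi (k1 - i.+2) else 0)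
   = - (ga t *: phi_prev t).
  case: (t) Ei => [|t'] Ei; first by rewrite ifF ?scaler0 ?oppr0 //; lia.
  have -> : (i.+1 < k1)%N by lia.
  by have -> : (k1 - i.+2 = t')%N; [lia | rewrite mulNr mul_polyC].
by rewrite opprB subrK subrr.
Qed.

(** Blocks 0 and 1 absorb the leading term: the recurrence expresses phi_k through phi_(k-1) and
    phi_(k-2). The remaining blocks are the lower coefficients in reverse order. *)
Lemma Dpoly_phi_sum m k1 (Dc : nat -> 'M[F]_m) : (0 < k1)%N ->
  \sum_(i < k1.+1) phi (k1 - i) *: mD_block al be ga k1 Dc i = Dpoly al be ga k1 Dc.
Proof.
case: k1 => // k _; rewrite /Dpoly (big_ord_recl k.+1) (big_ord_recl k) !big_ord_recr /= /bump /=.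
rewrite (reindex_inj rev_ord_inj) /= !add1n !subSS !subn0 /mD_block /=.
rewrite (eq_bigr (fun i : 'I_k => phi i *: polyM (Dc i))); last first.
  move=> i _; have lti := ltn_ord i.
  by rewrite !add1n /=; have -> : (k.+1 - (k - i.+1).+2 = i)%N by lia.
rewrite (phiS k.+1) /phi_prev; apply/matrixP => a b.
rewrite !mxE summxE -!mul_polyC !polyCM; ring.
Qed.

(** The matrix [[M_Phi; e_k^T]] is upper triangular with diagonal entries [- al t] and 1, all units,
    so its inverse is polynomial and agrees with the inverse over the fraction field. *)
Lemma QmatP k1 : exists Q : 'M[{poly F}]_(k1.+1, k1),
  [/\ liftP Q = Qmat al be ga k1, MPhi k1 *m Q = 1%:M,
      (delta_mx 0 ord_max : 'rV_k1.+1) *m Q = 0 &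
      Q *m MPhi k1 + phi_col k1 *m delta_mx 0 ord_max = 1%:M].
Proof.
pose e := addn1 k1; pose d : 'rV[{poly F}]_k1.+1 := delta_mx 0 ord_max.
pose Y := castmx (e, erefl) (col_mx (MPhi k1) d).
have YE i j : Y i j = if (i < k1)%N =P true is ReflectT lti then MPhi k1 (Ordinal lti) j
    else d 0 j.
  rewrite castmxE /= cast_ord_id mxE; case: eqP => [lti|ngei]; case: splitP => l /=.
  - by move=> El; congr (MPhi k1 _ _); apply: val_inj.
  - by move=> Ei; exfalso; lia.
  - by move=> Ei; case: ngei; rewrite Ei ltn_ord.
  - by rewrite ord1.
have uY : Y \in unitmx.
  (* The transpose is taken because [det_trig] expects a lower triangular matrix. *)
  rewrite -unitmx_tr unitmxE det_trig.
    apply/rpred_prod => i _; rewrite mxE YE; case: eqP => [lti|ngei].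
      by rewrite mxE /= eqxx unitrN poly_unitE size_polyC al_neq0 coefC unitfE /=.
    have -> : i = ord_max.
      by apply: val_inj; apply/eqP; rewrite eqn_leq -ltnS ltn_ord /= leqNgt; apply/negP.
    by rewrite mxE !eqxx unitr1.
  apply/is_trig_mxP => j i ltji; rewrite mxE YE; case: eqP => [lti|ngei].
    by rewrite mxE /= !ltn_eqF // ltnW // ltnW.
  by rewrite mxE eqxx -val_eqE ltn_eqF // (leq_trans ltji) // -ltnS.
have [MQ dQ [q Qq]] := @invmx_col_cast _ _ _ e _ d uY.
exists (invmx Y *m castmx (e, erefl) (col_mx 1%:M 0)); split=> //.
  rewrite liftPM /Qmat -/e.
  have liftY : castmx (e, erefl) (col_mx (liftP (MPhi k1))
      (liftC (delta_mx 0 ord_max : 'M[F]_(1, k1.+1)))) = liftP Y.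
    rewrite /Y /liftP map_castmx map_col_mx; congr (castmx _ (col_mx _ _)).
    by apply/matrixP => i j; rewrite !mxE -polyCMn.
  have uLY : liftP Y \in unitmx.
    apply: (proj1 (@mulmx1_unit _ _ _ (liftP (invmx Y)) _)).
    by rewrite -liftPM mulmxV // liftP1.
  rewrite liftY; congr (_ *m _); last first.
    by rewrite /liftP map_castmx map_col_mx map_mx1 map_mx0.
  by rewrite -[LHS]mulmx1 -(mulmxV uLY) mulmxA -liftPM mulVmx // liftP1 mul1mx.
suff -> : phi_col k1 = q by [].
(* Applying [Q M + q e_k^T = 1] to [phi_col] identifies [q]: [M] kills [phi_col], whose last entry
   is phi_0 = 1. *)
have dphi : d *m phi_col k1 = 1%:M.
  apply/matrixP => i j; rewrite !ord1 !mxE (bigD1 ord_max) //= big1 => [|l nl].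
    by rewrite !mxE !eqxx mul1r subnn addr0.
  by rewrite !mxE eqxx (negPf nl) mul0r.
by rewrite -[LHS]mul1mx -Qq mulmxDl -!mulmxA MPhi_phi !mulmx0 add0r dphi mulmx1.
Qed.

End ThreeTermRecurrence.

(** * Column degrees *)

Section ColumnDegrees.
Set Implicit Arguments.
Unset Strict Implicit.
Variable F : fieldType.

Lemma coldeg_polyM p q r (K : 'M[F]_(p, q)) (N : 'M_(q, r)) j :
  (coldeg (polyM K *m N) j <= coldeg N j)%N.
Proof.
apply/coldeg_leP => i; rewrite mxE (leq_trans (size_sum _ _ _)) //.
apply/bigmax_leqP => l _; rewrite mxE mul_polyC.
exact: leq_trans (size_scale_leq _ _) (size_le_coldeg _ _ _).
Qed.

Lemma coldegN p r (N : 'M[{poly F}]_(p, r)) j : coldeg (- N) j = coldeg N j.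
Proof. by apply: eq_bigr => i _; rewrite mxE size_polyN. Qed.

Lemma coldegD p r (M N : 'M[{poly F}]_(p, r)) d j :
  (coldeg M j <= d)%N -> (coldeg N j <= d)%N -> (coldeg (M + N) j <= d)%N.
Proof.
move=> /coldeg_leP leM /coldeg_leP leN; apply/coldeg_leP => i; rewrite mxE.
by rewrite (leq_trans (size_polyD _ _)) // geq_max leM leN.
Qed.

Lemma coldeg_col p q r (M : 'M[{poly F}]_(p, r)) (N : 'M_(q, r)) j :
  coldeg (col_mx M N) j = maxn (coldeg M j) (coldeg N j).
Proof.
rewrite /coldeg big_split_ord /=; congr maxn.
  by apply: eq_bigr => i _; rewrite col_mxEu.
by apply: eq_bigr => i _; rewrite col_mxEd.
Qed.

Lemma coldeg_blkP k m r (N : 'M[{poly F}]_(k * m, r)) d j :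
  reflect (forall i, (coldeg (blk N i) j <= d)%N) (coldeg N j <= d)%N.
Proof.
apply: (iffP idP) => [/coldeg_leP le i|le].
  by apply/coldeg_leP => a; rewrite mxE.
apply/coldeg_leP => u; case/mxvec_indexP: u => i a.
by have /coldeg_leP/(_ a) := le i; rewrite mxE.
Qed.

(* Compare the leading coefficients of the largest degree entry of [x]. *)
Lemma coldeg_shift p r (K : 'M[F]_p) (x y : 'M[{poly F}]_(p, r)) j :
  'X *: x = polyM K *m x + y -> (coldeg x j <= coldeg y j)%N.
Proof.
move=> Ex; apply/coldeg_leP => i.
case: (@arg_maxnP _ i xpredT (fun i => size (x i j))) => // i0 _ max_i0.
apply: leq_trans (max_i0 i isT) _; rewrite leqNgt; apply/negP => lt_d.
have xn0 : x i0 j != 0 by rewrite -size_poly_gt0 (leq_ltn_trans _ lt_d).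
have /matrixP/(_ i0 j)/(congr1 (fun q : {poly F} => size q)) := Ex.
rewrite !mxE mulrC size_mulX // => szE.
suff: ((size (x i0 j)).+1 <= size (x i0 j))%N by rewrite ltnn.
rewrite szE (leq_trans (size_polyD _ _)) // geq_max; apply/andP; split; last first.
  by rewrite (leq_trans (size_le_coldeg _ _ _)) // ltnW.
rewrite (leq_trans (size_sum _ _ _)) //; apply/bigmax_leqP => l _.
by rewrite mxE mul_polyC; apply: leq_trans (size_scale_leq _ _) (max_i0 l isT).
Qed.

End ColumnDegrees.

(** * Null spaces of the linearization *)

(** Solves the state equation for both null spaces; the left one uses transposed data. *)
Lemma mulmx_add_eq0 (R : comUnitRingType) n m r (T P S : 'M[R]_n) (B : 'M_(n, m))
    (x : 'M_(n, r)) h : T \in unitmx -> P \in unitmx -> S \in unitmx ->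
  T *m (P *m (S *m x) + B *m h) = 0 <-> x = - (invmx S *m invmx P *m B *m h).
Proof.
move=> uT uP uS; split=> [/(congr1 (mulmx (invmx T)))|->].
  rewrite mulKmx // mulmx0 => /eqP; rewrite addr_eq0 => /eqP E1.
  by rewrite -!mulmxA -mulmxN -mulmxN -E1 !mulKmx.
by rewrite !mulmxN -!mulmxA !mulKVmx // addNr mulmx0.
Qed.

Lemma unitmx_trW (R : comUnitRingType) n (P : 'M[R]_n) : P \in unitmx -> P^T \in unitmx.
Proof. by rewrite unitmx_tr. Qed.

(** Puts the left state formula into the shape produced by [mulmx_add_eq0], with [- X^T] as input
    matrix. *)
Lemma tr_mulmx_inv (R : comUnitRingType) n m r (X : 'M[R]_(m, n)) (P T : 'M_n)
    (y : 'M_(m, r)) :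
  (X *m invmx P *m invmx T)^T *m y = - (invmx T^T *m invmx P^T *m - X^T *m y).
Proof. by rewrite !trmx_mul !trmx_inv mulmxN mulNmx opprK !mulmxA. Qed.

Section Linearization.
Set Implicit Arguments.
Unset Strict Implicit.
Variables (F : fieldType) (al be ga : nat -> F).
Hypothesis al_neq0 : forall j, al j != 0.
Variables (m n k1 : nat).
Hypothesis k1_gt0 : (0 < k1)%N.
Variables (Dc : nat -> 'M[F]_m) (A : 'M[F]_n) (B : 'M[F]_(n, m)) (C : 'M[F]_(m, n)).
Hypothesis min_ABC : minimal_realization A B C.
Variables (w : 'cV[F]_k1.+1) (J : 'M[F]_(k1.+1 * m, k1 * m)).
Hypothesis uW : Wmat w J \in unitmx.
Variables (T S : 'M[F]_n).
Hypotheses (uT : T \in unitmx) (uS : S \in unitmx).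

Local Notation RF := (RF F).
Local Notation G := (Gmat al be ga k1 Dc A B C).
Local Notation L := (liftP (L2 al be ga Dc A B C w J T S)).
Local Notation W := (Wmat w J).
Local Notation mDb := (blockT_row (mD al be ga k1 Dc)).
Local Notation M := (MPhi al be ga k1).
Local Notation pencilA := ((lamF F)%:M - liftC A).

Lemma liftP_kron1 a b p (P : 'M[{poly F}]_(a, b)) :
  liftP (kron P (1%:M : 'M_p)) = kron (liftP P) 1%:M.
Proof. exact: map_kron1. Qed.

Lemma polyM_kron1 a b p (P : 'M[F]_(a, b)) :
  polyM (kron P (1%:M : 'M_p)) = kron (polyM P) 1%:M.
Proof. exact: map_kron1. Qed.

Lemma liftP_blk k p r (x : 'M[{poly F}]_(k * p, r)) i : blk (liftP x) i = liftP (blk x i).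
Proof. exact: blk_map. Qed.

Lemma blk_mDb i : blk mDb i = mD_block al be ga k1 Dc i.
Proof.
rewrite blk_blockT_row; apply/matrixP => a s; rewrite !mxE.
by rewrite (mxvec_indexPE (fun j b => mD_block al be ga k1 Dc j a b)).
Qed.

Lemma sum_phi_mDb : \sum_(i < k1.+1) phi al be ga (k1 - i) *: blk mDb i = Dpoly al be ga k1 Dc.
Proof. by rewrite -Dpoly_phi_sum //; apply: eq_bigr => i _; rewrite blk_mDb. Qed.

(** The block row below the state equation, after the change of variables [W x2 = col_mx h v]. *)
Definition L2_bottom r (x1 : 'M[RF]_(n, r)) h v : 'M[RF]_(k1.+1 * m, r) :=
  liftP (lastblk k1 (- polyM (C *m S))) *m x1
  + (liftP mDb *m h + kron (liftP M)^T 1%:M *m v).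

Lemma L2E : L =
  block_mx (liftC T *m pencilA *m liftC S) (row_mx (liftC (T *m B)) 0)
           (liftP (lastblk k1 (- polyM (C *m S))))
           (row_mx (liftP mDb) (kron (liftP M)^T 1%:M))
  *m block_mx (1%:M : 'M_n) 0 0 (liftC W).
Proof.
rewrite /L2 liftPM; congr (_ *m _).
  rewrite {1}/liftP map_block_mx -!/(liftP _) !liftPM liftP_pencil -!liftCE.
  congr block_mx.
    by rewrite liftP_row liftP0 -liftCE.
  by rewrite liftP_row liftP_kron1 liftP_tr.
by rewrite {1}/liftP map_block_mx -!/(liftP _) liftP1 !liftP0 -liftCE.
Qed.

Lemma mul_L2 r (x1 : 'M[RF]_(n, r)) x2 h v :
  liftC W *m x2 = col_mx h v -> L *m col_mx x1 x2 =
  col_mx (liftC T *m (pencilA *m (liftC S *m x1) + liftC B *m h)) (L2_bottom x1 h v).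
Proof.
move=> Ex2; rewrite L2E -mulmxA mul_block_col mul1mx !mul0mx addr0 add0r Ex2.
rewrite mul_block_col; congr col_mx.
  by rewrite mul_row_col mul0mx addr0 liftCM mulmxDr !mulmxA.
by rewrite mul_row_col.
Qed.

Lemma blk_L2_bottom r (x1 : 'M[RF]_(n, r)) h v i : blk (L2_bottom x1 h v) i =
  (if i == ord_max then - (liftC C *m (liftC S *m x1)) else 0)
  + (liftP (blk mDb i) *m h + \sum_j (liftP M) j i *: blk v j).
Proof.
rewrite !blkD; congr (_ + (_ + _)).
- rewrite blkM liftP_blk blk_lastblk; case: eqP => _; last by rewrite liftP0 mul0mx.
  by rewrite liftPN -liftCE liftCM mulNmx mulmxA.
- by rewrite blkM liftP_blk.
- by rewrite blk_kron1; apply: eq_bigr => j _; rewrite mxE.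
Qed.

Lemma mul_wI r (x2 : 'M[RF]_(k1.+1 * m, r)) :
  liftC (wI m w) *m x2 = usubmx (liftC W *m x2).
Proof. by rewrite {2}/liftC map_col_mx mul_col_mx col_mxKu. Qed.

Let uLW : liftC W \in unitmx := liftC_unit uW.
Let uLS : liftC S \in unitmx := liftC_unit uS.
Let uLT : liftC T \in unitmx := liftC_unit uT.

Lemma N2hatE : exists Q : 'M[{poly F}]_(k1.+1, k1),
  [/\ N2hat al be ga m k1 = liftP (kron Q^T 1%:M), M *m Q = 1%:M,
      (delta_mx 0 ord_max : 'rV_k1.+1) *m Q = 0
    & Q *m M + phi_col al be ga k1 *m delta_mx 0 ord_max = 1%:M].
Proof.
have [Q [EQ MQ dQ QM]] := QmatP be ga al_neq0 k1; exists Q; split=> //.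
by rewrite /N2hat -EQ liftP_kron1 liftP_tr.
Qed.

(** * The right null space of the linearization *)

Definition right_proj : 'M[{poly F}]_(m, n + k1.+1 * m) := row_mx 0 (polyM (wI m w)).
Definition right_lift : 'M[RF]_(n + k1.+1 * m, m) :=
  col_mx (- (invmx (liftC S) *m resolvent A *m liftC B))
         (invmx (liftC W) *m col_mx 1%:M (- (N2hat al be ga m k1 *m liftP mDb))).

Lemma mul_right_proj r (x : 'M[RF]_(n + k1.+1 * m, r)) :
  liftP right_proj *m x = usubmx (liftC W *m dsubmx x).
Proof.
rewrite -[x in LHS]vsubmxK liftP_row -liftCE liftP0.
by rewrite mul_row_col mul0mx add0r mul_wI.
Qed.

Lemma mul_right_lift r (y : 'M[RF]_(m, r)) : right_lift *m y =
  col_mx (- (invmx (liftC S) *m resolvent A *m liftC B *m y))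
    (invmx (liftC W) *m col_mx y (- (N2hat al be ga m k1 *m liftP mDb *m y))).
Proof. by rewrite mul_col_mx mulNmx -(mulmxA (invmx (liftC W))) mul_col_mx mul1mx mulNmx. Qed.

Lemma right_projK : liftP right_proj *m right_lift = 1%:M.
Proof. by rewrite mul_right_proj /right_lift col_mxKd (mulKVmx uLW) col_mxKu. Qed.

Lemma state_eq r (x1 : 'M[RF]_(n, r)) h :
  (liftC T *m (pencilA *m (liftC S *m x1) + liftC B *m h) = 0) <->
  x1 = - (invmx (liftC S) *m resolvent A *m liftC B *m h).
Proof.
exact: mulmx_add_eq0 uLT (pencil_unit A) uLS.
Qed.

(** The last row of [Q] is zero, so [N2hat] kills the state coupling, which sits in the last block;
    [M Q = 1] makes it a left inverse of the Kronecker factor in front of [v]. *)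
Lemma N2hat_L2_bottom r (x1 : 'M[RF]_(n, r)) h v :
  N2hat al be ga m k1 *m L2_bottom x1 h v = N2hat al be ga m k1 *m liftP mDb *m h + v.
Proof.
have [Q [-> MQ dQ _]] := N2hatE; rewrite /L2_bottom !mulmxDr !mulmxA -liftPM.
rewrite (_ : kron _ _ *m lastblk _ _ = 0) ?liftP0 ?mul0mx ?add0r.
  congr (_ + _); rewrite -mulmxA liftP_kron1 kron1M.
  by rewrite liftP_tr -trmx_mul -liftPM MQ liftP1 trmx1 kron11.
apply: blk_inj => i; rewrite blk_kron1 blk0 (bigD1 ord_max) //= big1 => [|j nj].
  rewrite mxE; move/matrixP/(_ 0 i): dQ; rewrite !mxE (bigD1 ord_max) //= big1.
    by rewrite !mxE !eqxx mul1r addr0 => ->; rewrite scale0r addr0.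
  by move=> j nj; rewrite !mxE (negPf nj) mul0r.
by rewrite blk_lastblk (negPf nj) scaler0.
Qed.

(** The first block row determines [x1] from [h], and [N2hat] applied to the second determines
    [v]. *)
Lemma right_liftK r (x : 'M[RF]_(n + k1.+1 * m, r)) :
  L *m x = 0 -> x = right_lift *m (liftP right_proj *m x).
Proof.
move=> Lx0; rewrite mul_right_proj mul_right_lift.
set h := usubmx _; set v := dsubmx (liftC W *m dsubmx x).
have EW : liftC W *m dsubmx x = col_mx h v by rewrite vsubmxK.
move: Lx0; rewrite -{1}[x]vsubmxK (mul_L2 _ EW) -[0]col_mx0 => /eq_col_mx[].
move=> /state_eq E1 /(congr1 (mulmx (N2hat al be ga m k1))) /eqP.
rewrite N2hat_L2_bottom mulmx0 addrC addr_eq0 => /eqP Ev.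
by rewrite -{1}[x]vsubmxK -E1 -Ev -EW (mulKmx uLW).
Qed.

(** Substituting [Q M = 1 - Phi e_k^T] cancels [mD] in every block but the last, where [Phi] sums
    its blocks to [D]; the state adds the transfer function there. The residual yields both
    directions of the null space correspondence. *)
Lemma L2_right_lift r (y : 'M[RF]_(m, r)) :
  L *m (right_lift *m y) = col_mx 0 (colblk (fun i => if i == ord_max then G *m y else 0)).
Proof.
rewrite mul_right_lift; move Ex1: (- _) => x1; move Ev: (- (_ *m y)) => v.
have E1 := (state_eq x1 y).2 (esym Ex1).
have EW := mulKVmx uLW (col_mx y v).
rewrite (mul_L2 _ EW) E1; congr col_mx.
apply: blk_inj => i; rewrite colblkK blk_L2_bottom.
have [Q [EN MQ dQ QM]] := N2hatE.
have -> : \sum_j liftP M j i *: blk v j = blk (liftP (kron M^T 1%:M) *m v) i.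
  by rewrite liftP_kron1 blk_kron1; apply: eq_bigr => j _; rewrite liftP_tr [in RHS]mxE.
rewrite -Ev EN mulmxN [liftP _ *m (_ *m y)]mulmxA -!liftPM kron1M -trmx_mul.
have -> : Q *m M = 1%:M - phi_col al be ga k1 *m delta_mx 0 ord_max.
  by rewrite -QM addrK.
rewrite linearB /= trmx1.
have -> : kron (1%:M - (phi_col al be ga k1 *m delta_mx 0 ord_max)^T) 1%:M *m mDb =
   mDb - kron (phi_col al be ga k1 *m delta_mx 0 ord_max)^T 1%:M *m mDb.
  by apply/eqP; rewrite eq_sym subr_eq -kron1D subrK kron11.
rewrite liftPD liftPN mulmxBl blkN blkD blkN !blkM opprB [X in _ + X]addrC.
rewrite !liftP_blk subrK blk_kron1.
have -> : \sum_j (phi_col al be ga k1 *m delta_mx 0 ord_max)^T i j *: blk mDb j =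
   if i == ord_max then Dpoly al be ga k1 Dc else 0.
  case: eqP => [->|ni].
    rewrite -sum_phi_mDb; apply: eq_bigr => j _; congr (_ *: _).
    by rewrite !mxE big_ord1 !mxE !eqxx mulr1.
  rewrite big1 // => j _; rewrite !mxE big_ord1 !mxE eqxx.
  by case: eqP => // _; rewrite mulr0 scale0r.
case: eqP => _; last by rewrite liftP0 mul0mx addr0.
rewrite mulmxDl addrC; congr (_ + _).
by rewrite -Ex1 !mulmxN opprK -!mulmxA (mulKVmx uLS) /transfer !mulmxA.
Qed.

Lemma right_ker_lift r (y : 'M[RF]_(m, r)) : G *m y = 0 -> L *m (right_lift *m y) = 0.
Proof.
move=> Gy0; rewrite L2_right_lift -[RHS]col_mx0; congr col_mx.
by apply: blk_inj => i; rewrite colblkK Gy0 if_same blk0.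
Qed.

Lemma right_ker_proj r (x : 'M[RF]_(n + k1.+1 * m, r)) :
  L *m x = 0 -> G *m (liftP right_proj *m x) = 0.
Proof.
move=> Lx0; have := Lx0; rewrite {1}(right_liftK Lx0) L2_right_lift -[RHS]col_mx0.
move=> /eq_col_mx[_ /(congr1 (fun z => blk z ord_max))].
by rewrite colblkK eqxx blk0.
Qed.

Lemma right_lift_poly r (y : 'M[{poly F}]_(m, r)) :
  G *m liftP y = 0 -> is_poly (right_lift *m liftP y).
Proof.
move=> Gy0; rewrite mul_right_lift; apply: is_poly_col; last first.
  rewrite -(liftC_inv uW); apply: is_polyM; first exact: is_polyC.
  apply: is_poly_col; first exact: is_poly_lift.
  have [Q [-> _ _ _]] := N2hatE.
  by apply/is_polyN; rewrite -!liftPM; apply: is_poly_lift.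
apply/is_polyN; rewrite -!mulmxA -(liftC_inv uS).
apply: is_polyM; first exact: is_polyC.
(* Observability is applied to the state vector, the resolvent times [B y], whose image under the
   pencil is [B y]. *)
apply: (observable_poly min_ABC).
  by rewrite mulmx_resolvent liftCE -liftPM; apply: is_poly_lift.
(* Since [G y = 0], the output of that state is [- D y], hence polynomial. *)
move: Gy0; rewrite /Gmat mulmxDl addrC => /eqP; rewrite addr_eq0 => /eqP.
rewrite /transfer -!mulmxA => ->; rewrite -liftPM -liftPN; exact: is_poly_lift.
Qed.

(** Only block 0 of [mD] involves the variable, and that block row is left out of the degree
    estimate. *)
Lemma mD_block_const i : exists D : 'M[F]_m, mD_block al be ga k1 Dc i.+1 = polyM D.
Proof.
rewrite /mD_block /=; case: eqP => _; last by eexists.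
by eexists; rewrite -polyMN -polyMD.
Qed.

(** Without its first column, [M_Phi] is the square pencil [X - K^T]; this is [K], the constant
    matrix required by [coldeg_shift]. *)
Definition MPhi_const : 'M[F]_k1 := \matrix_(j, l) let t := (k1 - 1 - l)%N in
  if j == l :> nat then be t else if j == l.+1 :> nat then ga t
  else if j.+1 == l then al t else 0.

Lemma MPhi_lift (l j : 'I_k1) :
  M l (lift ord0 j) = (if l == j then 'X else 0) - (MPhi_const j l)%:P.
Proof.
rewrite !mxE lift0 !eqSS; have [<-|nlj] := eqVneq l j.
  by rewrite eqxx gtn_eqF.
have -> : (j == l :> nat) = false by rewrite eq_sym val_eqE (negPf nlj).
rewrite sub0r; case: (j.+1 =P l) => [e|_].
  by have -> : (j == l.+1 :> nat) = false by lia.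
by rewrite /=; case: ifP => _; rewrite ?polyC0 ?oppr0.
Qed.

(** Two shift identities bound the state and [v] by the degree of [h]; the constant invertible [S]
    and [W] carry the bounds back to [N]. *)
Lemma right_coldeg r (N : 'M[{poly F}]_(n + k1.+1 * m, r)) j :
  L *m liftP N = 0 -> coldeg N j = coldeg (right_proj *m N) j.
Proof.
move=> LN0; set x1 := usubmx N; set x2 := dsubmx N.
set u := polyM W *m x2; set h := usubmx u; set v := dsubmx u.
have EN : N = col_mx x1 x2 by rewrite vsubmxK.
have Eu : u = col_mx h v by rewrite vsubmxK.
have Eh : right_proj *m N = h.
  rewrite EN /right_proj mul_row_col mul0mx add0r /h /u {2}/polyM map_col_mx.
  by rewrite mul_col_mx col_mxKu.
have EW : liftC W *m liftP x2 = col_mx (liftP h) (liftP v).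
  by rewrite liftCE -liftPM -/u {1}Eu liftP_col.
have := LN0; rewrite {1}EN liftP_col (mul_L2 _ EW) -[RHS]col_mx0.
move=> /eq_col_mx[/(congr1 (mulmx (invmx (liftC T)))) + Z0].
rewrite (mulKmx uLT) mulmx0; set z := polyM S *m x1 => P0.
have Ez : 'X *: z = polyM A *m z + - (polyM B *m h).
  apply: liftP_inj; apply/eqP; rewrite -subr_eq0 -P0 liftPD liftPN !liftPZ !liftPM -!liftCE.
  by rewrite mulmxBl mul_scalar_mx opprD opprK addrA.
have degz : (coldeg z j <= coldeg h j)%N.
  by rewrite (leq_trans (coldeg_shift _ Ez)) // coldegN coldeg_polyM.
pose y := colblk (fun i : 'I_k1 => - (blk mDb (lift ord0 i) *m h)
  + if lift ord0 i == ord_max then polyM C *m z else 0).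
(* These are block rows 1 to [k1] of the bottom equation, in which [h] and [z] have constant
   coefficients. *)
have Ev : 'X *: v = polyM (kron MPhi_const 1%:M) *m v + y.
  apply: blk_inj => i; rewrite blkD colblkK polyM_kron1 blk_kron1.
  have := congr1 (fun x => blk x (lift ord0 i)) Z0; rewrite blk0 blk_L2_bottom.
  have -> : \sum_l liftP M l (lift ord0 i) *: blk (liftP v) l =
      liftP ('X *: blk v i - \sum_l polyM MPhi_const i l *: blk v l).
    rewrite (eq_bigr (fun l => liftP (M l (lift ord0 i) *: blk v l))); last first.
      by move=> l _; rewrite liftP_blk liftPZ mxE.
    rewrite -raddf_sum; congr liftP.
    rewrite (eq_bigr (fun l => (if l == i then 'X else 0) *: blk v l
      - polyM MPhi_const i l *: blk v l)); last first.
      by move=> l _; rewrite MPhi_lift scalerBl [polyM MPhi_const i l]mxE.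
    rewrite big_split /= sumrN (bigD1 i) //= eqxx big1 ?addr0 // => l /negPf ->.
    by rewrite scale0r.
  have -> : (if lift ord0 i == ord_max then - (liftC C *m (liftC S *m liftP x1)) else 0)
      = liftP (- if lift ord0 i == ord_max then polyM C *m z else 0).
    by case: eqP => _; rewrite ?oppr0 ?liftP0 // liftPN !liftPM -!liftCE.
  rewrite -liftPM -!liftPD -[RHS](liftP0 F) => /liftP_inj E0.
  have -> : blk ('X *: v) i = 'X *: blk v i by apply/matrixP => a c; rewrite !mxE.
  apply/eqP; rewrite -subr_eq0 -[X in _ == X]E0 !opprD opprK addrA [X in _ == X]addrC.
  by rewrite [X in X == _]addrA (addrC (blk mDb _ *m _)).
have degv : (coldeg v j <= coldeg h j)%N.
  apply: leq_trans (coldeg_shift _ Ev) _; apply/coldeg_blkP => i; rewrite colblkK.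
  apply: coldegD; last first.
    case: eqP => _; first by rewrite (leq_trans (coldeg_polyM _ _ _)).
    by apply/coldeg_leP => a; rewrite mxE size_poly0.
  rewrite coldegN blk_mDb; have [D ->] := mD_block_const i.
  exact: coldeg_polyM.
apply/eqP; rewrite eqn_leq Eh {1}EN coldeg_col geq_max -andbA; apply/and3P; split.
- by rewrite -[x1](mulKmx (polyM_unit uS)) -polyM_inv (leq_trans (coldeg_polyM _ _ _)).
- rewrite -[x2](mulKmx (polyM_unit uW)) -polyM_inv (leq_trans (coldeg_polyM _ _ _)) //.
  by rewrite -/u Eu coldeg_col geq_max leqnn.
rewrite -Eh EN mul_row_col mul0mx add0r coldeg_col (leq_trans (coldeg_polyM _ _ _)) //.
exact: leq_maxr.
Qed.

(** * The left null space of the linearization *)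

Definition left_proj : 'M[{poly F}]_(m, n + k1.+1 * m) := row_mx 0 (lastblk k1 1%:M)^T.
(** This is [Phi] tensored with the identity, built by blocks so that its width is [m] rather than
    [1 * m]. *)
Definition phi_mx : 'M[{poly F}]_(k1.+1 * m, m) :=
  colblk (fun i : 'I_k1.+1 => (phi al be ga (k1 - i))%:M).
Definition left_lift : 'M[RF]_(n + k1.+1 * m, m) :=
  col_mx (liftC C *m resolvent A *m invmx (liftC T))^T (liftP phi_mx).

Lemma mul_tr_lastblk p r (X : 'M[{poly F}]_(m, p)) (x : 'M[RF]_(k1.+1 * m, r)) :
  (liftP (lastblk k1 X))^T *m x = (liftP X)^T *m blk x ord_max.
Proof.
rewrite mul_tr_blk (bigD1 ord_max) //= big1 => [|i /negPf ni].
  by rewrite liftP_blk blk_lastblk eqxx addr0.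
by rewrite liftP_blk blk_lastblk ni liftP0 trmx0 mul0mx.
Qed.

Lemma mul_left_proj r (x : 'M[RF]_(n + k1.+1 * m, r)) :
  liftP left_proj *m x = blk (dsubmx x) ord_max.
Proof.
rewrite -[x in LHS]vsubmxK liftP_row liftP0 liftP_tr.
by rewrite mul_row_col mul0mx add0r mul_tr_lastblk liftP1 trmx1 mul1mx.
Qed.

Lemma left_projK : liftP left_proj *m left_lift = 1%:M.
Proof.
by rewrite mul_left_proj /left_lift col_mxKd liftP_blk colblkK subnn liftP1.
Qed.

Lemma mul_trL2 r (x1 : 'M[RF]_(n, r)) x2 : L^T *m col_mx x1 x2 =
  col_mx ((liftC S)^T *m (pencilA^T *m ((liftC T)^T *m x1)
            + - (liftC C)^T *m blk x2 ord_max))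
    ((liftC W)^T *m col_mx ((liftC B)^T *m ((liftC T)^T *m x1) + (liftP mDb)^T *m x2)
                           (kron (liftP M) 1%:M *m x2)).
Proof.
rewrite L2E trmx_mul !tr_block_mx -[LHS]mulmxA !mul_block_col trmx1 !trmx0 !mul0mx mul1mx.
rewrite addr0 add0r; congr col_mx.
  rewrite mul_tr_lastblk liftPN -liftCE liftCM mulmxDr linearN /= !trmx_mul.
  by rewrite !mulNmx mulmxN !mulmxA.
congr (_ *m _); rewrite !tr_row_mx !mul_col_mx add_col_mx trmx0 mul0mx add0r.
by rewrite kron1_tr trmxK liftCM trmx_mul mulmxA.
Qed.

(** Applying [Q M + Phi e_k^T = 1] to a null vector leaves [Phi] times its last block; conversely
    [M] kills [Phi]. *)
Lemma kerMPhiP r (x : 'M[RF]_(k1.+1 * m, r)) :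
  kron (liftP M) 1%:M *m x = 0 <-> x = liftP phi_mx *m blk x ord_max.
Proof.
have [Q [_ _ _ QM]] := N2hatE; split=> [Mx0|->].
  rewrite -{1}[x]kron11 -liftP1 -QM liftPD kron1D !liftPM -kron1M Mx0 mulmx0 add0r.
  apply: blk_inj => i; rewrite blk_kron1 blkM liftP_blk colblkK (bigD1 ord_max) //=.
  rewrite big1 => [|j nj].
    rewrite addr0 -liftPM /liftP map_scalar_mx mul_scalar_mx; congr (_ *: _).
    by rewrite !mxE big_ord1 !mxE !eqxx mulr1.
  by rewrite -liftPM !mxE big_ord1 !mxE (negPf nj) mulr0 tofrac0 scale0r.
rewrite mulmxA -liftP_kron1 -liftPM (_ : _ *m phi_mx = 0) ?liftP0 ?mul0mx //.
apply: blk_inj => i; rewrite blk_kron1 blk0.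
under eq_bigr do rewrite colblkK scale_scalar_mx.
rewrite -raddf_sum /=.
have /matrixP/(_ i 0) := MPhi_phi be ga al_neq0 k1; rewrite !mxE.
rewrite (eq_bigr (fun j : 'I_k1.+1 => M i j * phi al be ga (k1 - j))) => [->|j _].
  by rewrite raddf0.
by congr (_ * _); rewrite mxE.
Qed.

(** After cancelling [W^T], three equations remain: the state equation fixes [x1], the [M_Phi]
    equation fixes [x2], and the last one becomes [G^T y = 0]. *)
Lemma left_kerP r (x1 : 'M[RF]_(n, r)) x2 : let y := blk x2 ord_max in
  L^T *m col_mx x1 x2 = 0 <-> col_mx x1 x2 = left_lift *m y /\ G^T *m y = 0.
Proof.
move=> y; rewrite mul_trL2 -/y mul_col_mx.
have Ex1 : (liftC C *m resolvent A *m invmx (liftC T))^T *m y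
    = - (invmx (liftC T)^T *m invmx pencilA^T *m - (liftC C)^T *m y).
  exact: tr_mulmx_inv.
have state := mulmx_add_eq0 (- (liftC C)^T) x1 y
  (unitmx_trW uLS) (unitmx_trW (pencil_unit A)) (unitmx_trW uLT).
have EG : x1 = (liftC C *m resolvent A *m invmx (liftC T))^T *m y ->
    x2 = liftP phi_mx *m y ->
    (liftC B)^T *m ((liftC T)^T *m x1) + (liftP mDb)^T *m x2 = G^T *m y.
  move=> -> ->; rewrite /Gmat linearD /= [RHS]mulmxDl addrC; congr (_ + _).
    rewrite mulmxA; congr (_ *m _).
    rewrite -!liftP_tr -liftPM mul_tr_blk -sum_phi_mDb linear_sum /=.
    congr liftP; apply: eq_bigr => i _; rewrite colblkK linearZ /=.
    by rewrite mul_mx_scalar.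
  rewrite (mulmxA (liftC T)^T) mulmxA; congr (_ *m _).
  by rewrite -!trmx_mul; congr (_^T); rewrite (mulmxKV uLT).
split=> [|[/eq_col_mx[E1 E2] Gy0]].
  rewrite -[RHS]col_mx0 => /eq_col_mx[/state]; rewrite -Ex1 => E1.
  move=> /(congr1 (mulmx (invmx (liftC W)^T))); rewrite (mulKmx (unitmx_trW uLW)) mulmx0.
  rewrite -[RHS]col_mx0 => /eq_col_mx[E0 /kerMPhiP E2].
  by rewrite -EG // -E1 -E2.
rewrite -[RHS]col_mx0; congr col_mx; first by apply/state; rewrite -Ex1.
by rewrite EG // Gy0 ((kerMPhiP _).2 E2) col_mx0 mulmx0.
Qed.

Lemma left_liftK r (x : 'M[RF]_(n + k1.+1 * m, r)) :
  L^T *m x = 0 -> x = left_lift *m (liftP left_proj *m x).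
Proof.
by rewrite mul_left_proj -{1 2}[x]vsubmxK => /left_kerP[].
Qed.

Lemma left_ker_proj r (x : 'M[RF]_(n + k1.+1 * m, r)) :
  L^T *m x = 0 -> G^T *m (liftP left_proj *m x) = 0.
Proof. by rewrite mul_left_proj -{1}[x]vsubmxK => /left_kerP[]. Qed.

Lemma left_ker_lift r (y : 'M[RF]_(m, r)) : G^T *m y = 0 -> L^T *m (left_lift *m y) = 0.
Proof.
move=> Gy0; rewrite -[left_lift *m y]vsubmxK; apply/left_kerP.
have E : liftP left_proj *m (left_lift *m y) = y by rewrite mulmxA left_projK mul1mx.
by rewrite vsubmxK -mul_left_proj E.
Qed.

(** Observability of the transposed realization makes the state part polynomial; [G^T y = 0]
    expresses its output through [D^T y]. *)
Lemma left_lift_poly r (y : 'M[{poly F}]_(m, r)) :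
  G^T *m liftP y = 0 -> is_poly (left_lift *m liftP y).
Proof.
move=> Gy0; rewrite mul_col_mx; apply: is_poly_col; last first.
  by rewrite -liftPM; apply: is_poly_lift.
rewrite !trmx_mul -(liftC_inv uT) -mulmxA; apply: is_polyM.
  by apply: is_poly_tr; apply: is_polyC.
rewrite -resolvent_tr; apply: (observable_poly (minimal_realization_tr min_ABC)).
  rewrite -mulmxA mulmx_resolvent -liftC_tr liftCE -liftPM; exact: is_poly_lift.
move: Gy0; rewrite /Gmat linearD /= mulmxDl addrC => /eqP; rewrite addr_eq0 => /eqP.
rewrite -transfer_tr /transfer -!mulmxA -liftC_tr => ->.
rewrite -liftP_tr -liftPM -liftPN; exact: is_poly_lift.
Qed.

(** Block [i] of [x2] is phi_(k-1-i) times [y], so block 0 attains the shift [k1], while the state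
    has degree at most that of [y]. A zero column would have degree 0 on both sides, hence the
    nonvanishing condition. *)
Lemma left_coldeg r (N : 'M[{poly F}]_(n + k1.+1 * m, r)) j :
  L^T *m liftP N = 0 -> col j (left_proj *m N) != 0 ->
  coldeg N j = (coldeg (left_proj *m N) j + k1)%N.
Proof.
move=> LN0; set y := left_proj *m N; set x1 := usubmx N; set x2 := dsubmx N => yn0.
have EN : N = col_mx x1 x2 by rewrite vsubmxK.
have := left_liftK LN0; rewrite -liftPM -/y {1}EN liftP_col mul_col_mx.
move=> /eq_col_mx[_]; rewrite -liftPM => /liftP_inj Ex2.
have blkx2 i : blk x2 i = phi al be ga (k1 - i) *: y.
  by rewrite Ex2 blkM colblkK mul_scalar_mx.
have blkmax : blk x2 ord_max = y by rewrite blkx2 subnn scale1r.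
have := LN0; rewrite {1}EN liftP_col mul_trL2 -[RHS]col_mx0.
move=> /eq_col_mx[/(congr1 (mulmx (invmx (liftC S)^T))) + _].
rewrite (mulKmx (unitmx_trW uLS)) mulmx0 liftP_blk blkmax => P0.
set z := polyM T^T *m x1.
have Ez : 'X *: z = polyM A^T *m z + polyM C^T *m y.
  apply: liftP_inj; apply/eqP; rewrite -subr_eq0 -P0 liftPD !liftPZ !liftPM -!liftCE.
  by rewrite !liftC_tr linearB /= tr_scalar_mx mulmxBl mul_scalar_mx mulNmx opprD addrA.
have degz : (coldeg z j <= coldeg y j)%N.
  by rewrite (leq_trans (coldeg_shift _ Ez)) // coldeg_polyM.
apply/eqP; rewrite eqn_leq {1}EN coldeg_col geq_max -andbA; apply/and3P; split.
- rewrite -[x1](mulKmx (polyM_unit (unitmx_trW uT))) -polyM_inv (leq_trans (coldeg_polyM _ _ _)) //.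
  by rewrite (leq_trans degz) ?leq_addr.
- apply/coldeg_blkP => i; rewrite blkx2; apply/coldeg_leP => a; rewrite mxE.
  apply: leq_trans (size_polyMleq _ _) _; rewrite size_phi // addSn /=.
  by rewrite (leq_trans (leq_add (leq_subr i k1) (size_le_coldeg y a j))) // addnS addnC.
(* An entry of largest size in column [j] is nonzero and realizes the column degree. *)
have [a ya0 degy] : exists2 a, y a j != 0 & (coldeg y j < size (y a j))%N.
  have [/existsP[a0 ya0]|] := boolP [exists a, y a j != 0]; last first.
    rewrite negb_exists => /forallP y0; case/eqP: yn0; apply/matrixP => a c.
    by rewrite mxE [RHS]mxE; apply/eqP; rewrite -[_ == _]negbK y0.
  case: (@arg_maxnP _ a0 xpredT (fun i => size (y i j))) => // a _ max_a.
  have ya : y a j != 0.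
    by rewrite -size_poly_gt0 (leq_trans _ (max_a a0 isT)) // size_poly_gt0.
  exists a => //; rewrite -(ltn_predK (_ : (0 < size (y a j))%N)) ?size_poly_gt0 //.
  rewrite ltnS; apply/coldeg_leP => i.
  by rewrite prednK ?size_poly_gt0 //; apply: max_a.
have Ex2a : x2 (mxvec_index ord0 a) j = phi al be ga k1 * y a j.
  by have /matrixP/(_ a j) := blkx2 ord0; rewrite [LHS]mxE [RHS]mxE subn0.
have := size_le_coldeg x2 (mxvec_index ord0 a) j; rewrite Ex2a.
have phi_neq0 : phi al be ga k1 != 0 by rewrite -size_poly_gt0 size_phi.
rewrite (size_mul phi_neq0 ya0) size_phi // EN coldeg_col.
rewrite addSn /= => le_x2; apply: leq_trans (leq_maxr _ _); rewrite -ltnS.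
by apply: leq_trans le_x2; rewrite addnC -addnS leq_add2l.
Qed.

(** * Assembly of the two correspondences *)

Lemma right_kernel_iso : kernel_iso 0 G L right_proj right_lift.
Proof.
split; first exact: right_projK.
- exact: right_liftK.
- exact: right_ker_proj.
- exact: right_ker_lift.
- exact: right_lift_poly.
- by move=> r N j LN0 _; rewrite addn0; apply: right_coldeg.
Qed.

Lemma left_kernel_iso : kernel_iso k1 G^T L^T left_proj left_lift.
Proof.
split; first exact: left_projK.
- exact: left_liftK.
- exact: left_ker_proj.
- exact: left_ker_lift.
- exact: left_lift_poly.
- exact: left_coldeg.
Qed.

Lemma right_projE r (H : 'M[{poly F}]_(n + k1.+1 * m, r)) :
  right_proj *m H = polyM (wI m w) *m dsubmx H.
Proof. by rewrite -[H in LHS]vsubmxK mul_row_col mul0mx add0r. Qed.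

Lemma left_projE r (H : 'M[{poly F}]_(n + k1.+1 * m, r)) :
  left_proj *m H = rblock (dsubmx H) ord_max.
Proof.
apply: liftP_inj; rewrite liftPM mul_left_proj -liftP_blk; congr (blk _ _).
by rewrite -{1}[H]vsubmxK liftP_col col_mxKd.
Qed.

End Linearization.

(* k = k1.+1 is the degree of D (so k - 1 = k1); k >= 2 means 1 <= k1. *)
Theorem theorem7p4 (F : fieldType) (al be ga : nat -> F)
  (hal : forall j, al j != 0)
  (m n k1 : nat) (hk : (1 <= k1)%N)
  (Dc : nat -> 'M[F]_m) (hDk : Dc k1.+1 != 0)
  (A : 'M[F]_n) (B : 'M[F]_(n, m)) (C : 'M[F]_(m, n))
  (hmin : minimal_realization A B C)
  (w : 'cV[F]_k1.+1) (J : 'M[F]_(k1.+1 * m, k1 * m))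
  (hWJ : Wmat w J \in unitmx)
  (T S : 'M[F]_n) (hT : T \in unitmx) (hS : S \in unitmx) :
  let G := Gmat al be ga k1 Dc A B C in
  let L := liftP (L2 al be ga Dc A B C w J T S) in
  let Wt := liftC (wI m w) in
  (* (a) *)
  (forall r (H : 'M[{poly F}]_(n + k1.+1 * m, r)),
     right_minimal_basis L H ->
     right_minimal_basis G (polyM (wI m w) *m dsubmx H) /\
     liftP (usubmx H) = - (invmx (liftC S) *m resolvent A *m liftC B *m Wt *m liftP (dsubmx H)))
  /\
  (* (b) *)
  (forall r (H : 'M[{poly F}]_(m, r)),
     right_minimal_basis G H ->
     exists (H1 : 'M[{poly F}]_(n, r)) (H2 : 'M[{poly F}]_(k1.+1 * m, r)),
       liftP H1 = - (invmx (liftC S) *m resolvent A *m liftC B *m liftP H) /\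
       liftP H2 = invmx (liftC (Wmat w J)) *m
                  col_mx (liftP H) (- (N2hat al be ga m k1 *m liftP (blockT_row (mD al be ga k1 Dc)) *m liftP H)) /\
       right_minimal_basis L (col_mx H1 H2))
  /\
  (* (c) *)
  (forall r (H : 'M[{poly F}]_(n + k1.+1 * m, r)),
     let Hk1 := rblock (dsubmx H) ord_max in
     left_minimal_basis L H <->
     [/\ left_minimal_basis G Hk1,
         liftP (usubmx H) = (liftC C *m resolvent A *m invmx (liftC T))^T *m liftP Hk1 &
         forall i : 'I_k1.+1, (i < k1)%N ->
           rblock (dsubmx H) i = phi al be ga (k1 - i) *: Hk1])
  /\
  (* (d) *)
  (forall s : seq nat, right_min_indices G s -> right_min_indices L s)
  /\
  (* (e) *)
  (forall s : seq nat, left_min_indices G s -> left_min_indices L (map (addn k1) s)).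

Proof.
move=> G L Wt.
have isoR := right_kernel_iso be ga hal hk Dc hmin hWJ hT hS.
have isoL := left_kernel_iso be ga hal hk Dc hmin hWJ hT hS.
split; [|split; [|split; [|split]]].
- move=> r H mH; split.
    by have := transfer_minimal_proj isoR mH; rewrite right_projE.
  have [[LH0 _ _] _] := mH; have := kernel_iso_liftK isoR LH0.
  rewrite -liftPM right_projE mul_right_lift -{1}[H]vsubmxK liftP_col.
  by move=> /eq_col_mx[-> _]; rewrite liftPM -liftCE -/Wt !mulmxA.
- move=> r H mH; have [[GH0 _ _] _] := mH.
  have [H' EH'] := kernel_iso_poly isoR GH0.
  exists (usubmx H'), (dsubmx H').
  have := EH'; rewrite mul_right_lift -{1}[H']vsubmxK liftP_col.
  move=> /eq_col_mx[E1 E2]; split; first by rewrite -E1.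
  split; first by rewrite -E2.
  by rewrite vsubmxK; exact: (transfer_minimal_lift isoR (esym EH') mH).
- move=> r H Hk1; split=> [mH|[mHk1 E1 E2]].
    have mHk1 := transfer_minimal_proj isoL mH; rewrite left_projE in mHk1.
    have [[LH0 _ _] _] := mH; have := kernel_iso_liftK isoL LH0.
    rewrite -liftPM left_projE -/Hk1 mul_col_mx -{1}[H]vsubmxK liftP_col.
    move=> /eq_col_mx[E1]; rewrite -liftPM => /liftP_inj E2; split=> // i _.
    (* [rblock] and [blk] are convertible. *)
    change (blk (dsubmx H) i = phi al be ga (k1 - i) *: Hk1).
    by rewrite E2 blkM colblkK mul_scalar_mx.
  apply: (transfer_minimal_lift isoL _ mHk1).
  rewrite mul_col_mx -{1}[H]vsubmxK liftP_col E1; congr col_mx.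
  rewrite -liftPM; congr liftP; apply: blk_inj => i.
  rewrite blkM colblkK mul_scalar_mx; have [lti|gei] := ltnP i k1; first exact: E2.
  (* The only index outside the hypothesis is the last one, where phi_0 = 1. *)
  have -> : i = ord_max by apply: val_inj; apply/eqP; rewrite eqn_leq -ltnS ltn_ord.
  by rewrite subnn scale1r.
- by move=> s /(transfer_minimal_indices isoR); rewrite (eq_map add0n) map_id.
- by move=> s /(transfer_minimal_indices isoL).
Qed.
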